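(* Let $\varphi$ be a Drinfeld module over $\mathcal{O}$ of rank $r\ge2$ with $\varphi_\varpi(X)=\sum_{i=0}^{rd}H_iX^{q^i}$. Then $\varphi$ admits the canonical submodule scheme if and only if $(q^d,v(H_d))$ is a vertex of the Newton polygon of $\varphi_\varpi(X)$.
   Context: $q$ is a prime power, $A=\mathbb{F}_q[T]$, $\varpi\in A$ monic irreducible of degree $d\ge1$, $\wp=(\varpi)$, $\kappa(\wp)=A/\wp$, $A_\wp$ the $\wp$-adic completion, $\mathbb{C}_\wp$ the completion of an algebraic closure of $\operatorname{Frac}(A_\wp)$, with valuation $v$ and absolute value normalized by $|\varpi|=q^{-d}$. $\mathcal{O}\subset\mathbb{C}_\wp$ is a local subring containing $A_\wp$, complete for $|\cdot|$, with maximal ideal $\{v>0\}$. A Drinfeld module of rank $r$ over $\mathcal{O}$ is a ring homomorphism $\varphi:A\to\operatorname{End}(\mathbb{G}_{a,\mathcal{O}})$ (endomorphisms being $\mathbb{F}_q$-linear polynomials in $\mathcal{O}[X]$ under composition) with $\varphi_\varpi(X)=\sum_{i=0}^{rd}H_iX^{q^i}$, $H_0=\varpi$, $H_{rd}\in\mathcal{O}^\times$. The Newton polygon of $\sum a_iX^i$ is the lower convex hull of the points $(i,v(a_i))$ with $a_i\neq0$. Let $\varphi[\varpi]$ be the $\varpi$-torsion subscheme, $\delta_0=\min\{|x|:0\ne x\in\varphi[\varpi](\mathbb{C}_\wp)\}$, $\varphi[\varpi]_{\le\delta_0}=\{x\in\varphi[\varpi](\mathbb{C}_\wp):|x|\le\delta_0\}$;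 if this is a free $\kappa(\wp)$-module of rank 1 via $\varphi$ it is the canonical submodule. An $A$-submodule scheme $C\subset\varphi[\varpi]$ defined over $\mathcal{O}$ is the canonical submodule scheme if $C(\mathbb{C}_\wp)$ is the canonical submodule.
   Formalization: The maximal ideal {v>0} of 𝒪 is taken in Frac(𝒪): the non-units of 𝒪 are exactly the z in Frac(𝒪) with v(z)>0 (every complete valuation ring qualifies); with {v>0} read only inside 𝒪 the claim fails, e.g. for 𝒪=F_3[[T,y]], v(y)=1/2, φ_T=TX+yX^3+X^9. *)

(* Defs.v *)
From HB Require Import structures.
From mathcomp Require Import all_boot all_order all_algebra.
From mathcomp Require Import mxpoly fraction qpoly.
From mathcomp Require Import all_classical all_reals all_analysis.

Set Implicit Arguments.
Unset Strict Implicit.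
Unset Printing Implicit Defensive.

Import Order.TTheory GRing.Theory Num.Theory.

Local Open Scope classical_set_scope.
Local Open Scope ring_scope.

Definition deg (K : fieldType) (p : {poly K}) : nat := (size p).-1.

Section AbsoluteValues.
Context {R : realType}.

Record nonarch_abs (S : nzRingType) (N : S -> R) : Prop := {
  abs_ge0 : forall x, 0 <= N x ;
  abs_eq0 : forall x, N x = 0 <-> x = 0 ;
  absM : forall x y, N (x * y) = N x * N y ;
  abs_ultra : forall x y, N (x + y) <= Num.max (N x) (N y) }.

Definition abs_cauchy (S : nzRingType) (N : S -> R) (u : nat -> S) : Prop :=
  forall e, 0 < e -> exists n0 : nat, forall m n : nat,
    (n0 <= m)%N -> (n0 <= n)%N -> N (u m - u n) < e.

Definition abs_cvg (S : nzRingType) (N : S -> R) (u : nat -> S) (l : S) : Prop :=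
  forall e, 0 < e -> exists n0 : nat, forall n : nat,
    (n0 <= n)%N -> N (u n - l) < e.

Definition abs_complete (S : nzRingType) (N : S -> R) : Prop :=
  forall u, abs_cauchy N u -> exists l, abs_cvg N u l.

Record is_completion (S S' : nzRingType) (N : S -> R) (N' : S' -> R)
    (i : S -> S') : Prop := {
  completion_abs : nonarch_abs N' ;
  completion_isom : forall x, N' (i x) = N x ;
  completion_dense : forall y e, 0 < e -> exists x, N' (y - i x) < e ;
  completion_complete : abs_complete N' }.

End AbsoluteValues.

Section AdicAbs.
Context (R : realType) (Fq : finFieldType) (varpi : {poly Fq}).

(* If deg varpi >= 1 and varpi ^+ n divides a != 0, then n < size a, so the
   maximum below runs over all possible exponents. *)
Definition adic_ord (a : {poly Fq}) : nat :=
  (\max_(n < size a | (varpi ^+ n %| a)%R) n)%N.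

Definition adic_abs (a : {poly Fq}) : R :=
  if a == 0 then 0 else (#|Fq|%:R ^+ (deg varpi * adic_ord a))^-1.

End AdicAbs.

(* A -> A_p -> Frac(A_p) -> Kbar -> C_p, where A = Fq[T]; each stage is
   determined up to (isometric) isomorphism by the listed properties. *)
Record Cp_model (R : realType) (Fq : finFieldType) (varpi : {poly Fq}) := {
  Ap : idomainType ;
  Ap_abs : Ap -> R ;
  Ap_of : {rmorphism {poly Fq} -> Ap} ;
  Ap_completion : is_completion (adic_abs R varpi) Ap_abs Ap_of ;

  Kbar : fieldType ;
  Kbar_abs : Kbar -> R ;
  Kbar_of : {rmorphism {fraction Ap} -> Kbar} ;
  Kbar_closed : GRing.closed_field_axiom Kbar ;
  Kbar_algebraic : forall x, algebraicOver Kbar_of x ;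
  Kbar_absP : nonarch_abs Kbar_abs ;
  Kbar_abs_ext : forall a : Ap, Kbar_abs (Kbar_of (FracField.tofrac a)) = Ap_abs a ;

  Cp : fieldType ;
  Cp_abs : Cp -> R ;
  Cp_of : {rmorphism Kbar -> Cp} ;
  Cp_completion : is_completion Kbar_abs Cp_abs Cp_of }.

Section CpModel.
Context (R : realType) (Fq : finFieldType) (varpi : {poly Fq}).
Variable M : Cp_model R varpi.

Definition Ap_to_Cp (a : Ap M) : Cp M := Cp_of M (Kbar_of M (FracField.tofrac a)).

Definition A_to_Cp (a : {poly Fq}) : Cp M := Ap_to_Cp (Ap_of M a).

(* Additive valuation attached to the absolute value, scaled by v(varpi) = 1. *)
Definition cp_val (z : Cp M) : \bar R :=
  if z == 0 then +oo%E
  else (ln (Cp_abs z) / ln (Cp_abs (A_to_Cp varpi)))%:E.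

(* The ring O, given by its embedding in C_p.  A ring is local with maximal
   ideal m iff m is an ideal and is the set of non-units; base_max says that
   this set is {z in Frac(O) | v(z) > 0}.  Taking {v > 0} inside O only would
   be too weak: O = Fq[[T, y]] with varpi = T and y in C_p transcendental over
   Fq((T)) would be allowed, and for q = 3, v(y) = 1/2 and
   phi_T = T X + y X^3 + X^9 the canonical submodule is not defined over O
   although (3, v(y)) is a vertex. *)
Record base_ring := {
  base_sort :> comUnitRingType ;
  base_incl : {rmorphism base_sort -> Cp M} ;
  base_inj : injective base_incl ;
  base_Ap : forall a : Ap M, exists x, base_incl x = Ap_to_Cp a ;
  base_complete : abs_complete (fun x => Cp_abs (base_incl x)) ;
  base_max : forall z : Cp M,
    (exists2 x, x \isn't a GRing.unit & base_incl x = z) <->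
    (exists2 ab, ab.2 != 0 & z = base_incl ab.1 / base_incl ab.2)
      /\ (0 < cp_val z)%E }.

End CpModel.

Section DrinfeldModules.
Context (R : realType) (Fq : finFieldType) (varpi : {poly Fq}).
Context (M : Cp_model R varpi) (O : base_ring M).

Definition Fq_linear (p : {poly O}) : Prop :=
  exists n (c : nat -> O), p = \sum_(i < n) c i *: 'X^(#|Fq| ^ i).

Record drinfeld_module (r : nat) (phi : {poly Fq} -> {poly O}) : Prop := {
  drinfeld_linear : forall a, Fq_linear (phi a) ;
  drinfeldD : forall a b, phi (a + b) = phi a + phi b ;
  drinfeldM : forall a b, phi (a * b) = phi a \Po phi b ;
  drinfeld1 : phi 1 = 'X ;
  drinfeld_rank : exists H : nat -> O,
    [/\ phi varpi = \sum_(i < (r * deg varpi).+1) H i *: 'X^(#|Fq| ^ i),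
        base_incl O (H 0%N) = A_to_Cp M varpi
      & H (r * deg varpi)%N \is a GRing.unit] }.

Variable phi : {poly Fq} -> {poly O}.

Definition drinfeld_act (B : comNzRingType) (g : {rmorphism O -> B})
    (a : {poly Fq}) (x : B) : B := (map_poly g (phi a)).[x].

(* Stability under opposites is that under the action of -1. *)
Definition A_submodule (B : comNzRingType) (g : {rmorphism O -> B})
    (S : set B) : Prop :=
  [/\ S 0, forall x y, S x -> S y -> S (x + y)
    & forall a x, S x -> S (drinfeld_act g a x)].

(* A closed subscheme of the affine line over O is given by an ideal I of
   O[X]; its B-points are the common zeros of I in B. *)
Definition is_ideal (I : set {poly O}) : Prop :=
  [/\ I 0, forall f g, I f -> I g -> I (f + g)
    & forall h f, I f -> I (h * f)].

Definition scheme_points (I : set {poly O}) (B : comNzRingType)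
    (g : {rmorphism O -> B}) : set B :=
  [set x | forall f, I f -> (map_poly g f).[x] = 0].

(* I (phi varpi) says that the subscheme is contained in phi[varpi]; being a
   submodule scheme is expressed on the functor of points. *)
Definition torsion_submodule_scheme (I : set {poly O}) : Prop :=
  [/\ is_ideal I, I (phi varpi)
    & forall (B : comNzRingType) (g : {rmorphism O -> B}),
        A_submodule g (scheme_points I g)].

Definition torsion : set (Cp M) :=
  [set x | drinfeld_act (base_incl O) varpi x = 0].

(* The set is finite, so that the infimum is a minimum. *)
Definition delta0 : R :=
  inf [set Cp_abs x | x in torsion `&` [set x | x != 0]].

Definition torsion_le_delta0 : set (Cp M) :=
  torsion `&` [set x | Cp_abs x <= delta0].

(* S is a submodule of phi[varpi](C_p) that has a basis {e} over the field
   A/(varpi), whose elements are represented by {poly %/ varpi}. *)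
Definition free_rank1 (S : set (Cp M)) : Prop :=
  [/\ A_submodule (base_incl O) S, S `<=` torsion
    & exists2 e, S e &
        set_bij [set: {poly %/ varpi}] S
          (fun c => drinfeld_act (base_incl O) (c : {poly Fq}) e)].

Definition canonical_submodule_scheme (I : set {poly O}) : Prop :=
  [/\ torsion_submodule_scheme I, free_rank1 torsion_le_delta0
    & scheme_points I (base_incl O) = torsion_le_delta0].

End DrinfeldModules.

Section NewtonPolygon.
Context {R : realType}.

Definition plane : Type := convex_lmodType (R^o * R^o)%type.

Definition convex_hull (S : set plane) : set plane :=
  [set P | forall K : set plane,
    convex_set (M := (R^o * R^o)%type) K -> S `<=` K -> K P].

Definition lower_hull (S : set plane) : set plane :=
  [set P | convex_hull S P /\
    forall y : R, convex_hull S (P.1, y) -> P.2 <= y].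

Context {C : fieldType} (v : C -> \bar R) (p : {poly C}).

(* The points with p`_i = 0 are left out because v 0 = +oo. *)
Definition newton_points : set plane :=
  [set P | exists i : nat, P.1 = i%:R /\ v p`_i = P.2%:E].

Definition newton_polygon : set plane := lower_hull newton_points.

(* A vertex is a point of the polygon that is not in the interior of a segment
   joining two other points of the polygon. *)
Definition newton_vertex (x : R) (y : \bar R) : Prop :=
  exists y0 : R, [/\ y = y0%:E, newton_polygon (x, y0)
    & forall (P Q : plane) (t : R),
        newton_polygon P -> newton_polygon Q -> 0 < t < 1 ->
        x = t * P.1 + (1 - t) * Q.1 -> y0 = t * P.2 + (1 - t) * Q.2 ->
        P = Q].

End NewtonPolygon.

(* Main.v *)
Require Import Defs.
From HB Require Import structures.
From mathcomp Require Import all_boot all_order all_algebra.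
From mathcomp Require Import polyXY fraction qpoly separable finfield ring lra.
From mathcomp Require abelian.
From mathcomp Require Import all_classical all_reals all_analysis.

(* Let V be the set of roots of P = phi_varpi in C_p, which is algebraically
   closed, and let C be the set of those x in V with |x| <= delta0.  Elements of
   A prime to varpi act on V by isometries, so C is a submodule containing the
   q^d elements of the orbit of any of its nonzero elements; hence C is free of
   rank 1 iff #|C| = q^d.  All nonzero elements of C have absolute value delta0,
   so the first edge of the Newton polygon of P joins the abscissae 1 and #|C|,
   and since 1 < q^d <= #|C|, there is a vertex above q^d iff #|C| = q^d.
   Finally, f = prod_(c in C) (X - c) always has coefficients in O: the iteration
   f_(k+1) = f_k + (P / P_n mod f_k), n = #|C|, starting from X^n, converges to f
   for the Gauss norm of radius delta0, and stays in O[X] because delta0 < 1.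
   The ideal (f) then defines the canonical submodule scheme. *)

Set Implicit Arguments.
Unset Strict Implicit.
Unset Printing Implicit Defensive.

Import Order.TTheory GRing.Theory Num.Theory.

Local Open Scope classical_set_scope.
Local Open Scope ring_scope.

(** * Calculus of a nonarchimedean absolute value on a field *)

Section NonArchimedeanField.
Context {R : realType} {F : fieldType} {N : F -> R} (hN : nonarch_abs N).

Lemma nabs0 : N 0 = 0. Proof. by apply/(abs_eq0 hN). Qed.

Lemma nabs_eq0 x : (N x == 0) = (x == 0).
Proof. by apply/eqP/eqP => /(abs_eq0 hN). Qed.

Lemma nabs_gt0 x : (0 < N x) = (x != 0).
Proof. by rewrite lt_def nabs_eq0 (abs_ge0 hN) andbT. Qed.

Lemma nabs1 : N 1 = 1.
Proof.
have n1 : N 1 != 0 by rewrite nabs_eq0 oner_eq0.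
by apply: (mulfI n1); rewrite -(absM hN) !mulr1.
Qed.

Lemma nabsN x : N (- x) = N x.
Proof.
rewrite -mulN1r (absM hN); suff -> : N (- 1) = 1 by rewrite mul1r.
apply/eqP; rewrite -(@pexpr_eq1 _ _ 2) ?(abs_ge0 hN) //.
by rewrite expr2 -(absM hN) mulrNN mulr1 nabs1.
Qed.

Lemma nabsB x y : N (x - y) = N (y - x).
Proof. by rewrite -nabsN opprB. Qed.

Lemma nabsX x n : N (x ^+ n) = N x ^+ n.
Proof. by elim: n => [|n IH]; rewrite ?nabs1 // !exprS (absM hN) IH. Qed.

Lemma nabsV x : N x^-1 = (N x)^-1.
Proof.
have [->|x0] := eqVneq x 0; first by rewrite invr0 nabs0 invr0.
have nx : N x != 0 by rewrite nabs_eq0.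
by apply: (mulfI nx); rewrite -(absM hN) !divff // nabs1.
Qed.

Lemma nabs_prod (I : Type) (r : seq I) (f : I -> F) :
  N (\prod_(i <- r) f i) = \prod_(i <- r) N (f i).
Proof. exact: (big_morph N (absM hN) nabs1). Qed.

Lemma nabsD_le x y B : N x <= B -> N y <= B -> N (x + y) <= B.
Proof. by move=> xB yB; apply: le_trans (abs_ultra hN _ _) _; rewrite ge_max xB. Qed.

Lemma nabsD_lt x y B : N x < B -> N y < B -> N (x + y) < B.
Proof. by move=> xB yB; apply: le_lt_trans (abs_ultra hN _ _) _; rewrite gt_max xB. Qed.

Lemma nabsB_le x y B : N x <= B -> N y <= B -> N (x - y) <= B.
Proof. by move=> xB yB; apply: nabsD_le; rewrite ?nabsN. Qed.

Lemma nabs_sum_le (I : Type) (r : seq I) (P : pred I) (f : I -> F) B :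
  0 <= B -> (forall i, P i -> N (f i) <= B) -> N (\sum_(i <- r | P i) f i) <= B.
Proof.
by move=> B0 fB; elim/big_rec: _ => [|i x Pi xB]; rewrite ?nabs0 ?nabsD_le ?fB.
Qed.

Lemma nabs_sum_lt (I : Type) (r : seq I) (P : pred I) (f : I -> F) B :
  0 < B -> (forall i, P i -> N (f i) < B) -> N (\sum_(i <- r | P i) f i) < B.
Proof.
by move=> B0 fB; elim/big_rec: _ => [|i x Pi xB]; rewrite ?nabs0 ?nabsD_lt ?fB.
Qed.

Lemma nabs_dominant x y : N y < N x -> N (x + y) = N x.
Proof.
move=> yx; apply/eqP; rewrite eq_le nabsD_le ?(ltW yx) //= leNgt.
apply/negP => lt; have : N (x + y - y) < N x by rewrite nabsD_lt ?nabsN.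
by rewrite addrK ltxx.
Qed.

End NonArchimedeanField.

(** * The completion of an algebraically closed field is algebraically closed *)

Lemma closed_field_split (F : fieldType) (p : {poly F}) :
  GRing.closed_field_axiom F ->
  exists r : seq F, p = lead_coef p *: \prod_(z <- r) ('X - z%:P).
Proof.
move=> clF; have [n] := ubnP (size p); elim: n p => // n IH p.
rewrite ltnS => sp; have [s1|s1] := eqVneq (size p) 1%N.
  by exists [::]; rewrite big_nil alg_polyC [LHS]size1_polyC ?s1 // lead_coefE s1.
have [p0|p0] := eqVneq p 0; first by exists [::]; rewrite p0 lead_coef0 scale0r.
have [x /factor_theorem [q pq]] := elimT (PreClosedField.closed_rootP clF p) s1.
have q0 : q != 0 by apply: contraNneq p0 => q0; rewrite pq q0 mul0r.
have [|r qr] := IH q.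
  by apply: leq_trans sp; rewrite pq size_Mmonic ?monicXsubC // size_XsubC addn2.
exists (x :: r); rewrite big_cons {1}pq mulrC pq lead_coefM lead_coefXsubC mulr1.
by rewrite {1}qr scalerAr.
Qed.

Section CompletionClosed.
Context {R : realType} {S S' : fieldType} {N : S -> R} {N' : S' -> R}.
Context {i : {rmorphism S -> S'}} (cmp : is_completion N N' i).

Let hN' := completion_abs cmp.

(* Roots of polynomials over [S] that converge to the given one form a Cauchy
   sequence if each is chosen as close as possible to its predecessor. *)
Lemma completion_closed :
  GRing.closed_field_axiom S -> GRing.closed_field_axiom S'.
Proof.
move=> clS n P n0.
(* [B] bounds all the coefficients and, being at least 1, also the roots of every approximating
   polynomial. *)
pose B := 1 + \sum_(j < n) N' (P j).
have sum0 (r : seq 'I_n) (p : pred 'I_n) : 0 <= \sum_(j <- r | p j) N' (P j).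
  by apply: sumr_ge0 => j _; exact: abs_ge0 hN' _.
have B1 : 1 <= B by rewrite lerDl.
have B0 : 0 < B := lt_le_trans ltr01 B1.
have B0w := ltW B0.
have PB j : (j < n)%N -> N' (P j) <= B.
  move=> jn; rewrite /B (bigD1 (Ordinal jn)) //= addrCA lerDl addr_ge0 //.
have BX j : (j <= n)%N -> B ^+ j <= B ^+ n by move=> jn; rewrite ler_weXn2l.
pose w k : R := k.+1%:R^-1.
have w0 k : 0 < w k by rewrite invr_gt0.
have w0w k := ltW (w0 k).
have w1 k : w k <= 1 by rewrite invf_le1 // ler1n.
have wm k l : (k <= l)%N -> w l <= w k by move=> kl; rewrite lef_pV2 ?posrE // ler_nat.
(* Coefficients known within [e k] give values within [w k ^+ n] on the disc of radius [B]; the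
   power [n] anticipates the product of [n] distances in [step]. *)
pose e k := (w k / B) ^+ n.
have e0 k : 0 < e k by rewrite exprn_gt0 // divr_gt0.
have e1 k : e k <= 1.
  rewrite exprn_ile1 ?divr_ge0 //.
  by rewrite ler_pdivrMr // mul1r (le_trans (w1 k)).
have em k l : (k <= l)%N -> e l <= e k.
  move=> kl; rewrite lerXn2r ?nnegrE ?divr_ge0 //.
  by rewrite ler_pM2r ?invr_gt0 // wm.
have eB k : e k * B ^+ n = w k ^+ n by rewrite -exprMn divfK // gt_eqF.
have [Q PQ] : {Q : nat -> nat -> S | forall k j, N' (P j - i (Q k j)) < e k}.
  have ex k j := completion_dense cmp (P j) (e0 k).
  by exists (fun k j => sval (cid (ex k j))) => k j; case: cid.
pose q k : {poly S} := 'X^n - \poly_(j < n) Q k j.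
have qm k : q k \is monic.
  by rewrite monicE lead_coefDl ?lead_coefXn // size_polyN size_polyXn ltnS size_poly.
have sq k : size (q k) = n.+1.
  by rewrite size_polyDl size_polyXn // size_polyN ltnS size_poly.
pose h k (x : S') := x ^+ n - \sum_(j < n) i (Q k j) * x ^+ j.
pose H x := x ^+ n - \sum_(j < n) P j * x ^+ j.
have hq k x : i (q k).[x] = h k (i x).
  rewrite /q hornerD hornerN hornerXn rmorphB rmorphXn /= horner_poly rmorph_sum.
  by congr (_ - _); apply: eq_bigr => j _; rewrite rmorphM rmorphXn.
have QB k j : (j < n)%N -> N' (i (Q k j)) <= B.
  move=> jn; rewrite -(subrK (P j) (i _)) (nabsD_le hN') ?PB // (nabsB hN').
  by rewrite (le_trans (ltW (PQ k j))) // (le_trans (e1 k)).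
have Hh k x : N' x <= B -> N' (H x - h k x) <= w k ^+ n.
  move=> xB; rewrite /H /h opprB addrC addrA subrK -sumrB.
  apply: (nabs_sum_le hN') => [|j _]; first by rewrite exprn_ge0.
  rewrite -mulrBl (absM hN') (nabsX hN') -eB ler_pM ?exprn_ge0 ?(abs_ge0 hN') //.
    by rewrite (nabsB hN') ltW.
  by rewrite (le_trans _ (BX _ (ltnW (ltn_ord j)))) // lerXn2r ?nnegrE ?(abs_ge0 hN').
have rootB k x : h k x = 0 -> N' x <= B.
  move=> /eqP; rewrite subr_eq0 => /eqP hx; rewrite leNgt; apply/negP => Bx.
  have x0 : 0 < N' x := lt_trans B0 Bx.
  suff : N' (x ^+ n) < N' x ^+ n by rewrite (nabsX hN') ltxx.
  rewrite hx (nabs_sum_lt hN') ?exprn_gt0 // => j _.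
  have jn := ltn_ord j; rewrite (absM hN') (nabsX hN').
  apply: (@lt_le_trans _ _ (N' x ^+ j.+1)); last first.
    by rewrite ler_weXn2l // (le_trans B1) // ltW.
  by rewrite exprS ltr_pM2r ?exprn_gt0 // (le_lt_trans (QB k j jn)).
(* The value of [q k.+1] at [x] has absolute value at most [w k ^+ n] and is the product of the
   differences between [x] and its [n] roots, so one of these roots is within [w k]. *)
have step k x : root (q k) x ->
    exists y, root (q k.+1) y && (N' (i x - i y) <= w k).
  move=> rx; have hx : h k (i x) = 0 by rewrite -hq (rootP rx) rmorph0.
  have xB := rootB _ _ hx.
  have [r qr] := closed_field_split (q k.+1) clS.
  rewrite (monicP (qm _)) scale1r in qr.
  have sr : size r = n by apply: succn_inj; rewrite -(sq k.+1) qr size_prod_XsubC.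
  have hk1 : N' (h k.+1 (i x)) <= w k ^+ n.
    rewrite -(subrK (H (i x)) (h k.+1 _)) (nabsD_le hN') //.
      rewrite (nabsB hN') (le_trans (Hh _ _ xB)) // lerXn2r ?nnegrE //.
      exact: wm.
    by rewrite -[H _]subr0 -hx Hh.
  apply: contrapT => nex; move: hk1; apply/negP; rewrite -ltNge -hq qr.
  rewrite horner_prod rmorph_prod /= (nabs_prod hN').
  have far z : z \in r -> w k < N' (i (('X - z%:P).[x])).
    move=> zr; rewrite ltNge; apply/negP => le; apply: nex; exists z.
    by rewrite qr root_prod_XsubC zr; move: le; rewrite !hornerE rmorphB.
  have -> : w k ^+ n = \prod_(z <- r) w k by rewrite big_const_seq count_predT iter_mulr_1 sr.
  rewrite big_seq [ltRHS]big_seq ltr_prod // => [|z /far].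
    apply/hasP; case: (r) sr => [/= n0'|z r' _]; first by rewrite -n0' in n0.
    by exists z; rewrite mem_head.
  by rewrite w0w.
have [u0 ru0] : exists x, root (q 0%N) x.
  by apply: (elimT (PreClosedField.closed_rootP clS _)); rewrite sq eqSS -lt0n.
(* The default [x] is never taken along [u], since each [u k] is a root of [q k]. *)
pose nxt k x := if pselect (root (q k) x) is left rx then sval (cid (step k x rx)) else x.
pose u := fix u k := if k is k'.+1 then nxt k' (u k') else u0.
have ru k : root (q k) (u k).
  elim: k => //= k IH; rewrite /nxt; case: pselect => // rx.
  by case: cid => y /= /andP[].
have uS k : N' (i (u k) - i (u k.+1)) <= w k.
  rewrite /= /nxt; case: pselect => [rx|/(_ (ru k))//].
  by case: cid => y /= /andP[].
have uD k m : (k <= m)%N -> N' (i (u k) - i (u m)) <= w k.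
  elim: m => [|m IH]; first by rewrite leqn0 => /eqP ->; rewrite subrr (nabs0 hN') ltW.
  rewrite leq_eqVlt => /predU1P[->|km]; first by rewrite subrr (nabs0 hN') ltW.
  rewrite -(subrKA (i (u m))) (nabsD_le hN') ?IH //.
  by rewrite (le_trans (uS m)) ?wm.
have wlt (d : R) : 0 < d -> exists k, w k < d.
  by move=> /ltr_add_invr[k]; rewrite add0r; exists k.
have [l ul] : exists l, abs_cvg N' (fun k => i (u k)) l.
  apply: completion_complete cmp _ _ => d /wlt[k kd]; exists k => m m' km km'.
  rewrite -(subrKA (i (u k))) (nabsD_lt hN') // ?(nabsB hN' (i (u m))).
    by rewrite (le_lt_trans (uD _ _ km)).
  by rewrite (le_lt_trans (uD _ _ km')).
have uB k : N' (i (u k)) <= B by apply: (rootB k); rewrite -hq (rootP (ru k)) rmorph0.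
have lB : N' l <= B.
  have [k /(_ k (leqnn k)) kl] := ul _ B0.
  by rewrite -(subKr (i (u k)) l) (nabsB_le hN') ?uB // ltW.
exists l; apply/eqP; rewrite -subr_eq0 -/(H l) -(nabs_eq0 hN') eq_le (abs_ge0 hN') andbT.
apply/ler_addgt0Pr => d d0; rewrite add0r.
have BBn : 0 < B * B ^+ n by rewrite mulr_gt0 ?exprn_gt0.
(* Each x^j - y^j is a multiple of x - y by a sum of monomials bounded on the disc. The Lipschitz
   bound carries the smallness of [H] from [i (u k)] to [l]. *)
have lip x y : N' x <= B -> N' y <= B -> N' (H x - H y) <= N' (x - y) * (B * B ^+ n).
  move=> xB yB.
  have powB j : (j <= n)%N -> N' (x ^+ j - y ^+ j) <= N' (x - y) * B ^+ n.
    case: j => [|j] jn.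
      by rewrite subrr (nabs0 hN') mulr_ge0 ?(abs_ge0 hN') ?exprn_ge0.
    rewrite subrXX (absM hN') ler_wpM2l ?(abs_ge0 hN') //.
    apply: (nabs_sum_le hN') => [|m _]; first by rewrite exprn_ge0.
    rewrite (absM hN') !(nabsX hN') (le_trans _ (BX _ (ltnW jn))) //.
    have mj : (m <= j)%N := ltn_ord m; rewrite -[X in _ <= B ^+ X](subnK mj) exprD.
    by rewrite ler_pM ?exprn_ge0 ?(abs_ge0 hN') // lerXn2r ?nnegrE ?(abs_ge0 hN').
  have -> : H x - H y = (x ^+ n - y ^+ n) - \sum_(j < n) P j * (x ^+ j - y ^+ j).
    under eq_bigr do rewrite mulrBr.
    by rewrite sumrB /H; ring.
  rewrite (nabsB_le hN') // mulrCA.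
    rewrite (le_trans (powB n _)) // ler_peMl ?mulr_ge0 ?(abs_ge0 hN') ?exprn_ge0 //.
  apply: (nabs_sum_le hN') => [|j _].
    by rewrite ?mulr_ge0 ?(abs_ge0 hN') ?exprn_ge0.
  by rewrite (absM hN') ler_pM ?(abs_ge0 hN') ?PB ?powB // ltnW.
have [k1 k1P] := ul (d / (B * B ^+ n)) (divr_gt0 d0 BBn).
have [k2 k2P] := wlt d d0.
pose k := maxn k1 k2.
rewrite -(subrK (H (i (u k))) (H l)) (nabsD_le hN') //.
  rewrite (le_trans (lip _ _ lB (uB k))) // -ler_pdivlMr // (nabsB hN') ltW //.
  by rewrite k1P // leq_maxl.
have -> : H (i (u k)) = H (i (u k)) - h k (i (u k)).
  by rewrite -hq (rootP (ru k)) rmorph0 subr0.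
rewrite (le_trans (Hh _ _ (uB k))) // (le_trans _ (ltW k2P)) //.
rewrite (le_trans _ (wm _ _ (leq_maxr k1 k2))) // -/k.
by rewrite -[leRHS]expr1 ler_wiXn2l.
Qed.
End CompletionClosed.

(** * Gauss norms and division by monic polynomials *)

Section GaussNorm.
Context {R : realType} {F : fieldType} {N : F -> R} (hN : nonarch_abs N).
Context {d : R} (d_gt0 : 0 < d).
Implicit Types (p q f g : {poly F}) (B : R).

Let d_ge0 := ltW d_gt0.
Let dX_gt0 n : 0 < d ^+ n. Proof. exact: exprn_gt0. Qed.
Let dX_ge0 n : 0 <= d ^+ n. Proof. exact: exprn_ge0. Qed.

(** An upper bound for the Gauss norm of radius [d], the maximum of |p_k| d^k; working with bounds
    avoids forming the maximum. *)
Definition gauss_le B p := forall k, N p`_k * d ^+ k <= B.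

Lemma gauss_leD B p q : gauss_le B p -> gauss_le B q -> gauss_le B (p + q).
Proof.
move=> pB qB k; rewrite -ler_pdivlMr // coefD.
by apply: (nabsD_le hN); rewrite ler_pdivlMr.
Qed.

Lemma gauss_leN B p : gauss_le B p -> gauss_le B (- p).
Proof. by move=> pB k; rewrite coefN (nabsN hN). Qed.

Lemma gauss_leB B p q : gauss_le B p -> gauss_le B q -> gauss_le B (p - q).
Proof. by move=> pB /gauss_leN; apply: gauss_leD. Qed.

Lemma gauss_leW B B' p : B <= B' -> gauss_le B p -> gauss_le B' p.
Proof. by move=> BB pB k; apply: le_trans (pB k) BB. Qed.

Lemma gauss_leM B B' p q : 0 <= B -> 0 <= B' ->
  gauss_le B p -> gauss_le B' q -> gauss_le (B * B') (p * q).
Proof.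
move=> B0 B'0 pB qB k; rewrite -ler_pdivlMr // coefM.
apply: (nabs_sum_le hN) => [|[j jk] _ /=]; first by rewrite divr_ge0 ?mulr_ge0.
rewrite ler_pdivlMr // (absM hN) -[X in d ^+ X](subnKC (ltnSE jk)) exprD mulrACA.
by rewrite ler_pM // mulr_ge0 // (abs_ge0 hN).
Qed.

Lemma gauss_leZ c B p : gauss_le B p -> gauss_le (N c * B) (c *: p).
Proof. by move=> pB k; rewrite coefZ (absM hN) -mulrA ler_wpM2l ?(abs_ge0 hN). Qed.

Lemma gauss_leXn n : gauss_le (d ^+ n) 'X^n.
Proof.
by move=> k; rewrite coefXn; case: eqP => [->|_];
  rewrite ?(nabs1 hN) ?(nabs0 hN) ?mul1r ?mul0r.
Qed.

(** Each step of the long division subtracts a multiple of [f] whose norm is at most |lead p| d^(k +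
    n), which is one of the terms bounded by [B]; so the bound survives down to the remainder. *)
Lemma gauss_le_modp n f B p : f \is monic -> size f = n.+1 ->
  gauss_le (d ^+ n) f -> 0 <= B -> gauss_le B p -> gauss_le B (p %% f).
Proof.
move=> mf sf fB B0; have [m] := ubnP (size p); elim: m p => // m IH p.
rewrite ltnS => sp pB; have [lt|le] := ltnP (size p) (size f).
  by rewrite modp_small.
have p0 : (0 < size p)%N by apply: leq_trans le; rewrite sf.
pose k := ((size p).-1 - n)%N; pose t := lead_coef p *: ('X^k * f).
have knp : (k + n)%N = (size p).-1 by rewrite subnK // -ltnS -sf prednK.
have -> : p %% f = (p - t) %% f.
  by rewrite modpD modpN /t modpZl modp_mull scaler0 oppr0 addr0.
have st : size ('X^k * f) = size p.
  rewrite mulrC size_Mmonic ?monicXn ?monic_neq0 // sf size_polyXn addSn addnS /=.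
  by rewrite addnC knp prednK.
apply: IH.
  apply: leq_trans sp; rewrite -(prednK p0) ltnS.
  apply/leq_sizeP => j; rewrite leq_eqVlt => /predU1P[<-|]; rewrite coefB coefZ.
    have -> : ('X^k * f)`_(size p).-1 = 1.
      by rewrite -{1}st -lead_coefE lead_coefM lead_coefXn (monicP mf) mulr1.
    by rewrite mulr1 -lead_coefE subrr.
  rewrite prednK // => lt; rewrite nth_default // [X in _ * X]nth_default ?st //.
  by rewrite mulr0 subr0.
apply: gauss_leB => //; rewrite /t.
apply: gauss_leW (gauss_leZ (lead_coef p) (gauss_leM _ _ (gauss_leXn k) fB)) => //.
by rewrite -exprD knp lead_coefE.
Qed.

Lemma gauss_le_small (r : seq F) : (forall x, x \in r -> N x <= d) ->
  gauss_le (d ^+ size r) (\prod_(x <- r) ('X - x%:P)).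
Proof.
elim: r => [_|x r IH rd].
  by rewrite big_nil; move=> [|k]; rewrite ?expr0 coef1 ?(nabs1 hN) ?(nabs0 hN) ?mulr1 ?mul0r.
rewrite big_cons exprS; apply: gauss_leM => //; last first.
  by apply: IH => y yr; rewrite rd // inE yr orbT.
move=> [|[|k]]; rewrite coefB coefX coefC ?subr0 ?sub0r /=.
- by rewrite (nabsN hN) expr0 mulr1 rd ?mem_head.
- by rewrite (nabs1 hN) mul1r expr1.
- by rewrite (nabs0 hN) mul0r.
Qed.

(** A factor X - x with |x| > d is strictly dominated by its constant term, a property that passes
    to products. *)
Lemma gauss_lt_large (r : seq F) (g := \prod_(x <- r) ('X - x%:P)) :
  (forall x, x \in r -> d < N x) ->
  0 < N g`_0 /\ forall k, N g`_k.+1 * d ^+ k.+1 < N g`_0.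
Proof.
rewrite {}/g; elim: r => [_|x r IH rd].
  by rewrite big_nil coef1 (nabs1 hN); split=> // k; rewrite coef1 (nabs0 hN) mul0r.
have [|g0 gk] := IH; first by move=> y yr; rewrite rd // inE yr orbT.
have dx : d < N x by rewrite rd ?mem_head.
have x0 : 0 < N x := lt_trans d_gt0 dx.
rewrite big_cons mulrBl; set g := \prod_(_ <- _) _ in g0 gk *.
have E0 : N ('X * g - x%:P * g)`_0 = N x * N g`_0.
  by rewrite coefB coefXM coefCM sub0r (nabsN hN) (absM hN).
have gk' k : N g`_k * d ^+ k <= N g`_0.
  by case: k => [|k]; [rewrite expr0 mulr1 | exact: ltW (gk k)].
split=> [|k]; rewrite E0 ?mulr_gt0 //.
rewrite -ltr_pdivlMr // coefB coefXM coefCM /=; apply: (nabsD_lt hN).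
  rewrite ltr_pdivlMr // exprS mulrCA (le_lt_trans (ler_wpM2l _ (gk' k))) //.
  by rewrite ltr_pM2r.
by rewrite ltr_pdivlMr // (nabsN hN) (absM hN) -mulrA ltr_pM2l // gk.
Qed.

(** Having finitely many coefficients turns strict inequalities into a uniform ratio [t], the
    contraction factor of the later iteration. *)
Lemma gauss_lt_le p : (forall k, N p`_k * d ^+ k < 1) ->
  exists2 t, 0 <= t < 1 & gauss_le t p.
Proof.
move=> p1.
suff [t t1 tP] : exists2 t, 0 <= t < 1 & forall k, (k < size p)%N -> N p`_k * d ^+ k <= t.
  exists t => // k; have [/tP//|sk] := ltnP k (size p).
  by rewrite nth_default // (nabs0 hN) mul0r; case/andP: t1.
elim: (size p) => [|n [t /andP[t0 t1] tP]]; first by exists 0; rewrite ?lexx ?ltr01.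
exists (Num.max t (N p`_n * d ^+ n)); first by rewrite le_max t0 gt_max t1 p1.
move=> k; rewrite ltnS leq_eqVlt le_max => /predU1P[->|/tP->] //.
by rewrite lexx orbT.
Qed.

(** * Coefficients of a polynomial whose roots are separated by the radius [d] *)

Section Slope.
Variables (c : F) (r s : seq F).
Hypotheses (c_neq0 : c != 0) (r_small : forall x, x \in r -> N x <= d).
Hypothesis s_large : forall x, x \in s -> d < N x.
Let f := \prod_(x <- r) ('X - x%:P).
Let g := \prod_(x <- s) ('X - x%:P).
Let p := c *: (f * g).
Let n := size r.

Let f_le : gauss_le (d ^+ n) f. Proof. exact: gauss_le_small. Qed.
Let g0_gt0 : 0 < N g`_0. Proof. by have [] := gauss_lt_large s_large. Qed.
Let g_lt k : (0 < k)%N -> N g`_k * d ^+ k < N g`_0.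
Proof. by case: k => // k _; have [_] := gauss_lt_large s_large. Qed.
Let g_le : gauss_le (N g`_0) g.
Proof. by case=> [|k]; [rewrite expr0 mulr1 | exact/ltW/g_lt]. Qed.
Let c_gt0 : 0 < N c. Proof. by rewrite (nabs_gt0 hN). Qed.
Let fn1 : f`_n = 1.
Proof.
have /monicP : f \is monic by rewrite monic_prod_XsubC.
by rewrite lead_coefE size_prod_XsubC.
Qed.

Let term_lt i k : (0 < k)%N -> N (f`_i * g`_k) * d ^+ (i + k) < d ^+ n * N g`_0.
Proof.
move=> k0; rewrite (absM hN) exprD mulrACA.
rewrite (le_lt_trans (ler_wpM2r _ (f_le i))) ?mulr_ge0 ?(abs_ge0 hN) //.
by rewrite ltr_pM2l // g_lt.
Qed.

(** In the convolution at index [n], the term i = n is the constant term of [g] because [f] is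
    monic; every other term involves a coefficient of [g] of positive index and is smaller. *)
Let coef_n_diff : N ((f * g)`_n - g`_0) < N g`_0.
Proof.
rewrite coefM big_ord_recr /= subnn fn1 mul1r addrK.
apply: (nabs_sum_lt hN) => // -[i i_lt] _ /=.
have := @term_lt i (n - i)%N; rewrite subn_gt0 subnKC ?(ltnW i_lt) // => /(_ i_lt).
by rewrite mulrC ltr_pM2l.
Qed.

Lemma slope_coef_n : N p`_n = N c * N g`_0.
Proof.
rewrite coefZ (absM hN); congr (_ * _).
by rewrite -[(f * g)`_n](subrKC g`_0) (nabs_dominant hN).
Qed.

Lemma slope_coef_neq0 : p`_n != 0.
Proof. by rewrite -(nabs_gt0 hN) slope_coef_n mulr_gt0. Qed.

Lemma slope_coef_le : gauss_le (N p`_n * d ^+ n) p.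
Proof.
rewrite slope_coef_n -mulrA; apply: gauss_leZ.
by rewrite mulrC; apply: gauss_leM => //; exact: ltW.
Qed.

(** Convolution terms with i <= n involve a coefficient of [g] of positive index, and those with i >
    n vanish. Thus [n] is the last point where the Newton polygon touches the supporting line
    attached to [d]. *)
Lemma slope_coef_lt k : (n < k)%N -> N p`_k * d ^+ k < N p`_n * d ^+ n.
Proof.
move=> nk; rewrite slope_coef_n coefZ (absM hN) -!mulrA ltr_pM2l //.
rewrite -ltr_pdivlMr // coefM; apply: (nabs_sum_lt hN) => [|[i ik] _ /=].
  by rewrite divr_gt0 ?mulr_gt0.
rewrite ltr_pdivlMr // [ltRHS]mulrC.
have [le|lt] := leqP i n.
  rewrite -[X in d ^+ X](subnKC (ltnSE ik)) term_lt // subn_gt0.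
  exact: leq_ltn_trans nk.
by rewrite nth_default ?size_prod_XsubC // mul0r (nabs0 hN) mul0r mulr_gt0.
Qed.

(** Since 0 is a simple root of [f], its linear coefficient is, up to sign, the product of its n - 1
    nonzero roots, all of absolute value [d]. This puts the index 1 on the same supporting line as
    [n]. *)
Lemma slope_coef_1 : uniq r -> 0 \in r ->
  (forall x, x \in r -> x != 0 -> N x = d) -> N p`_1 * d = N p`_n * d ^+ n.
Proof.
move=> ur r0 rd; rewrite slope_coef_n coefZ (absM hN) -!mulrA; congr (_ * _).
have -> : (f * g)`_1 = f`_1 * g`_0.
  rewrite coefM big_ord_recr big_ord1 /= addrC.
  have -> : f`_0 = 0 by rewrite -horner_coef0; apply/rootP; rewrite root_prod_XsubC.
  by rewrite mul0r addr0.
have -> : f`_1 = \prod_(x <- rem 0 r) - x.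
  rewrite /f (perm_big _ (perm_to_rem r0)) big_cons subr0 coefXM /=.
  rewrite -horner_coef0 horner_prod; apply: eq_bigr => x _.
  by rewrite !hornerE.
rewrite (absM hN) (nabs_prod hN) mulrAC mulrC; congr (_ * _).
have -> : n = (size (rem 0 r)).+1.
  by rewrite size_rem // prednK //; case: (r) r0.
rewrite exprSr; congr (_ * _).
rewrite -[size _]count_predT -iter_mulr_1 -big_const_seq !big_seq.
apply: eq_bigr => x xr; rewrite (nabsN hN) rd //; first exact: mem_rem xr.
by apply: contraTneq xr => ->; rewrite mem_rem_uniqF.
Qed.

(** The cofactor is [g] scaled by c / p_n: its constant term is close to 1 by [coef_n_diff], and its
    other coefficients are small because [g] is dominated by its constant term. *)
Lemma slope_cofactor : exists2 u, (p`_n)^-1 *: p = f * u &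
  exists2 t, 0 <= t < 1 & gauss_le t (u - 1).
Proof.
have pn0 := slope_coef_neq0.
exists ((c / p`_n) *: g); first by rewrite /p scalerA mulrC scalerAr.
apply: gauss_lt_le => -[|k].
  rewrite expr0 mulr1 coefB coef1 /= coefZ.
  have -> : c / p`_n * g`_0 - 1 = (- c) * ((f * g)`_n - g`_0) / p`_n.
    move: (pn0); rewrite [p`_n]coefZ mulf_eq0 negb_or => /andP[c0 h0].
    by field; rewrite c0 h0.
  rewrite (absM hN) (nabsV hN) slope_coef_n (absM hN) (nabsN hN).
  by rewrite ltr_pdivrMr ?mulr_gt0 // mul1r ltr_pM2l.
rewrite coefB coef1 subr0 coefZ !(absM hN) (nabsV hN) slope_coef_n.
rewrite invfM mulrA divff ?gt_eqF // mul1r -mulrA mulrC ltr_pdivrMr // mul1r.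
exact: g_lt.
Qed.

End Slope.

(* Writing [p = f * u = f' * u + e + e * (u - 1)] with [e = f - f'], the
   remainder by [f'] recovers [e] up to the small term [e * (u - 1)]. *)
Lemma slope_factor_step n f f' p u t B : f \is monic -> size f = n.+1 ->
  f' \is monic -> size f' = n.+1 -> gauss_le (d ^+ n) f' ->
  p = f * u -> 0 <= t -> gauss_le t (u - 1) -> 0 <= B -> gauss_le B (f - f') ->
  gauss_le (B * t) (f - (f' + p %% f')).
Proof.
move=> mf sf mf' sf' f'B pE t0 ut B0 ffB.
have -> : f - (f' + p %% f') = - (((f - f') * (u - 1)) %% f').
  have -> : p = u * f' + ((f - f') + (f - f') * (u - 1)) by rewrite pE; ring.
  rewrite modpD modp_mull add0r modpD [(f - f') %% f']modp_small; first by ring.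
  rewrite sf' ltnS; apply/leq_sizeP => j; rewrite leq_eqVlt coefB => /predU1P[<-|nj].
    move: (monicP mf) (monicP mf'); rewrite !lead_coefE sf sf' /= => -> ->.
    exact: subrr.
  by rewrite !nth_default ?sf ?sf' // subrr.
apply: gauss_leN; apply: (@gauss_le_modp n) => //; first exact: mulr_ge0.
exact: gauss_leM.
Qed.

End GaussNorm.

Lemma expr_lt_exists {R : realType} (t e : R) : 0 <= t < 1 -> 0 < e ->
  exists m, t ^+ m < e.
Proof.
move=> /andP[t0 t1] e0; have : `|t| < 1 by rewrite ger0_norm.
move=> /cvg_expr /cvgr0Pnorm_lt /(_ e e0) [m _ /(_ m (leqnn m))] /=.
by rewrite ger0_norm ?exprn_ge0 //; exists m.
Qed.

(** * The base ring: absolute values, closedness, and descent of factors *)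

Section BaseRing.
Context {R : realType} {Fq : finFieldType} {varpi : {poly Fq}}.
Hypotheses (varpi_monic : varpi \is monic) (varpi_irr : irreducible_poly varpi).
Context {M : Cp_model R varpi}.

Let N := @Cp_abs R Fq varpi M.
Let w := A_to_Cp M varpi.

Lemma Cp_nonarch : nonarch_abs (@Cp_abs R Fq varpi M).
Proof. exact: completion_abs (Cp_completion M). Qed.
Let hN : nonarch_abs N := Cp_nonarch.

Lemma Cp_closed : GRing.closed_field_axiom (Cp M).
Proof. exact: completion_closed (Cp_completion M) (@Kbar_closed _ _ _ M). Qed.

Lemma varpi_size : (1 < size varpi)%N. Proof. by case: varpi_irr. Qed.

Lemma varpi_abs : 0 < N w < 1.
Proof.
rewrite /N /w /A_to_Cp /Ap_to_Cp (completion_isom (Cp_completion M)).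
rewrite Kbar_abs_ext (completion_isom (Ap_completion M)).
rewrite /adic_abs (negbTE (monic_neq0 varpi_monic)).
have q1 : (1 : R) < #|Fq|%:R by rewrite ltr1n finNzRing_gt1.
rewrite invr_gt0 exprn_gt0 ?(lt_trans ltr01) //= invf_lt1 ?exprn_gt0 ?(lt_trans ltr01) //.
rewrite exprn_egt1 // muln_eq0 negb_or -!lt0n /deg -ltnS.
rewrite prednK ?varpi_size //=; last exact: ltnW varpi_size.
(* The exponent 1 is in the range of the maximum because [varpi] has size at least 2; hence the
   order is positive. *)
rewrite /adic_ord.
have /= := @leq_bigmax_cond _ (fun n : 'I_(size varpi) => varpi ^+ n %| varpi)
  (fun n => nat_of_ord n) (Ordinal varpi_size).
by apply; rewrite expr1 dvdpp.
Qed.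

Lemma cp_valE (z : Cp M) : z != 0 -> cp_val z = (ln (N z) / ln (N w))%:E.
Proof. by rewrite /cp_val => /negbTE ->. Qed.

Lemma cp_val_gt0 (z : Cp M) : (0 < cp_val z)%E = (N z < 1).
Proof.
have [->|z0] := eqVneq z 0.
  by rewrite /cp_val eqxx lt0y (nabs0 hN) ltr01.
rewrite cp_valE // lte_fin; have w0 := ln_lt0 varpi_abs.
have z0' : 0 < N z by rewrite (nabs_gt0 hN).
rewrite nmulr_lgt0 ?invr_lt0 //.
by rewrite -ln1 ltr_ln ?posrE.
Qed.

Context {O : base_ring M}.
Let i := base_incl O.

Lemma base_incl_eq0 x : (i x == 0) = (x == 0).
Proof. by rewrite -(inj_eq (@base_inj _ _ _ _ O)) rmorph0. Qed.

Lemma base_nonunit_abs x : x \isn't a GRing.unit -> N (i x) < 1.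
Proof.
move=> nu; rewrite -cp_val_gt0.
by have [/(_ (ex_intro2 _ _ x nu erefl))[]] := @base_max _ _ _ _ O (i x).
Qed.

(** This is how [base_max] keeps quotients inside [O] even when their denominators are not units. *)
Lemma base_frac_abs_lt1 a b : b != 0 -> N (i a / i b) < 1 ->
  exists x, i x = i a / i b.
Proof.
rewrite -cp_val_gt0 => b0 lt1; have [_ h] := @base_max _ _ _ _ O (i a / i b).
have [|x _ xE] := h; last by exists x.
by split=> //; exists (a, b).
Qed.

Lemma base_unit_abs_ge1 x : x \is a GRing.unit -> 1 <= N (i x).
Proof.
move=> ux; rewrite leNgt; apply/negP; rewrite -cp_val_gt0 => lt1.
have [_ h] := @base_max _ _ _ _ O (i x).
have [|y] := h.
  by split=> //; exists (x, 1); rewrite ?oner_neq0 //= rmorph1 divr1.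
by move=> /negP nu /(@base_inj _ _ _ _ O) yx; apply: nu; rewrite yx.
Qed.

Lemma base_abs_le1 x : N (i x) <= 1.
Proof.
have [ux|/base_nonunit_abs/ltW//] := boolP (x \is a GRing.unit).
have : 1 <= N (i x^-1) by rewrite base_unit_abs_ge1 ?unitrV.
rewrite rmorphV // (nabsV hN) => h; rewrite -[N _]invrK invf_le1 //.
exact: lt_le_trans h.
Qed.

Lemma base_unit_abs x : x \is a GRing.unit -> N (i x) = 1.
Proof. by move=> ux; apply/eqP; rewrite eq_le base_abs_le1 base_unit_abs_ge1. Qed.

(** Approximants at distance less than 1 / (k + 1) form a Cauchy sequence, whose limit in [O] must
    map to [z]. *)
Lemma base_closed (z : Cp M) : (forall e, 0 < e -> exists x, N (z - i x) < e) ->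
  exists x, i x = z.
Proof.
move=> zP.
have w0 k : 0 < k.+1%:R^-1 :> R by rewrite invr_gt0.
pose u k := sval (cid (zP _ (w0 k))).
have uz k : N (z - i (u k)) < k.+1%:R^-1 by rewrite /u; case: cid.
have wlt (e : R) : 0 < e -> exists k0, forall k, (k0 <= k)%N -> k.+1%:R^-1 < e.
  move=> /ltr_add_invr[k0]; rewrite add0r => lt; exists k0 => k kk.
  by rewrite (le_lt_trans _ lt) // lef_pV2 ?posrE // ler_nat.
have [|x ux] := @base_complete _ _ _ _ O u.
  move=> e /wlt[k0 k0P]; exists k0 => m n mk nk.
  rewrite rmorphB -(subrKA z) (nabsD_lt hN) //.
    by rewrite (nabsB hN) (lt_trans (uz _)) ?k0P.
  by rewrite (lt_trans (uz _)) ?k0P.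
exists x; apply/esym/eqP; rewrite -subr_eq0 -(nabs_eq0 hN) eq_le (abs_ge0 hN) andbT.
apply/ler_addgt0Pr => e e0; rewrite add0r.
have [k1 k1P] := wlt e e0; have [k2 k2P] := ux e e0.
rewrite -(subrKA (i (u (maxn k1 k2)))) (nabsD_le hN) ?ltW //.
  by rewrite (lt_trans (uz _)) ?k1P ?leq_maxl.
by rewrite -rmorphB k2P ?leq_maxr.
Qed.

Lemma base_poly_lift (p : {poly Cp M}) : (forall k, exists x, i x = p`_k) ->
  exists q : {poly O}, map_poly i q = p.
Proof.
move=> pP; exists (\poly_(k < size p) sval (cid (pP k))).
apply/polyP => k; rewrite coef_map coef_poly /=; case: ltnP => [lt|ge].
  by case: cid.
by rewrite nth_default /= ?rmorph0.
Qed.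

Lemma size_map_incl (p : {poly O}) : size (map_poly i p) = size p.
Proof. exact: size_map_inj_poly (@base_inj _ _ _ _ O) (rmorph0 _) _. Qed.

Lemma map_incl_inj : injective (map_poly i).
Proof. exact: map_inj_poly (@base_inj _ _ _ _ O) (rmorph0 _). Qed.

(** Over [O] the pseudo-division by a monic polynomial is a true Euclidean division, so uniqueness
    of the remainder over the field identifies its image. *)
Lemma map_incl_rmodp (p f : {poly O}) : f \is monic ->
  map_poly i (Pdiv.CommonRing.rmodp p f) = map_poly i p %% map_poly i f.
Proof.
move=> mf; rewrite {2}(Pdiv.RingMonic.rdivp_eq mf p) rmorphD rmorphM /=.
rewrite modp_addl_mul_small // !size_map_incl.
by rewrite Pdiv.CommonRing.ltn_rmodpN0 // monic_neq0.
Qed.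

Lemma map_incl_dvdp (p f : {poly O}) : f \is monic ->
  map_poly i f %| map_poly i p -> exists h, p = h * f.
Proof.
move=> mf /modp_eq0; rewrite -map_incl_rmodp // => /eqP.
rewrite -(rmorph0 (map_poly i)) => /eqP /map_incl_inj r0.
exists (Pdiv.CommonRing.rdivp p f).
by rewrite {1}(Pdiv.RingMonic.rdivp_eq mf p) r0 addr0.
Qed.

Lemma base_slope_factor (p : {poly O}) (c : Cp M) (r s : seq (Cp M)) (d : R) :
  0 < d -> d < 1 -> c != 0 ->
  (forall x, x \in r -> N x <= d) -> (forall x, x \in s -> d < N x) ->
  map_poly i p = c *: (\prod_(x <- r) ('X - x%:P) * \prod_(x <- s) ('X - x%:P)) ->
  exists f : {poly O}, map_poly i f = \prod_(x <- r) ('X - x%:P).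
Proof.
move=> d0 d1 c0 rd sd pE; set f := \prod_(x <- r) _ in pE *.
pose n := size r; have mf : f \is monic by rewrite monic_prod_XsubC.
have sf : size f = n.+1 by rewrite size_prod_XsubC.
have fle : gauss_le (N := N) (d := d) (d ^+ n) f := gauss_le_small hN d0 rd.
have [u] := slope_cofactor hN d0 c0 rd sd.
have := slope_coef_neq0 hN d0 c0 rd sd.
have := slope_coef_le hN d0 c rd sd.
rewrite -/f -/n -pE => ple pn0 pu [t /andP[t0 t1] ut].
have dX k : 0 < d ^+ k by rewrite exprn_gt0.
have pn0' : p`_n != 0 by rewrite -base_incl_eq0 -coef_map.
(* Dividing by the coefficient of index [n] makes the cofactor [u] close to 1, but leaves
   coefficients that are only known to be quotients of elements of [O]. *)
set P := _ *: _ in pu.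
have Ple : gauss_le (N := N) (d := d) (d ^+ n) P.
  move=> k; have := gauss_leZ hN ((map_poly i p)`_n)^-1 ple k.
  by rewrite (nabsV hN) mulKf // (nabs_eq0 hN).
have tX k : 0 <= t ^+ k by rewrite exprn_ge0.
have approx k : exists g : {poly O}, [/\ g \is monic, size g = n.+1
    & gauss_le (N := N) (d := d) (d ^+ n * t ^+ k) (f - map_poly i g)].
  elim: k => [|k [g [mg sg gk]]].
    exists 'X^n; rewrite monicXn size_polyXn expr0 mulr1; split=> //.
    by rewrite map_polyXn; apply: (gauss_leB hN d0) => //; exact: (gauss_leXn hN d0).
  have mg' : map_poly i g \is monic by rewrite monic_map.
  have sg' : size (map_poly i g) = n.+1 by rewrite size_map_incl.
  have gle : gauss_le (N := N) (d := d) (d ^+ n) (map_poly i g).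
    rewrite -[map_poly i g](subKr f); apply: (gauss_leB hN d0) => //.
    by apply: gauss_leW gk; rewrite ler_piMr ?(ltW (dX _)) ?exprn_ile1 // ltW.
  have B0 : 0 <= d ^+ n * t ^+ k by rewrite mulr_ge0 ?(ltW (dX _)).
  have := slope_factor_step hN d0 mf sf mg' sg' gle pu t0 ut B0 gk.
  have Pmod := gauss_le_modp hN d0 mg' sg' gle (ltW (dX n)) Ple.
  have Pmod_size : (size (P %% map_poly i g)%R <= n)%N.
    by rewrite -ltnS -sg' ltn_modpN0 // monic_neq0.
  have [j|h hE] := @base_poly_lift (P %% map_poly i g).
    have [nj|jn] := leqP n j.
      by exists 0; rewrite rmorph0 nth_default // (leq_trans Pmod_size).
    (* The coefficient of index [j] is a quotient of elements of [O] bounded by d^(n - j), with j <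
       n and d < 1; so it lies in [O] by [base_frac_abs_lt1]. *)
    have E : (P %% map_poly i g)`_j =
        i (Pdiv.CommonRing.rmodp p g)`_j / i p`_n.
      by rewrite /P modpZl -map_incl_rmodp // coefZ !coef_map mulrC.
    have := Pmod j; rewrite E => Pj; apply: base_frac_abs_lt1 => //.
    move: Pj; rewrite -[X in _ <= d ^+ X](subnK (ltnW jn)) exprD ler_pM2r //.
    by move=> /le_lt_trans; apply; rewrite exprn_ilt1 ?ltW // -lt0n subn_gt0.
  exists (g + h); rewrite rmorphD /= hE exprSr mulrA.
  have hg : (size h < size g)%N by rewrite sg ltnS -size_map_incl hE.
  by split=> //; rewrite ?size_polyDl // monicE lead_coefDl // -monicE.
apply: base_poly_lift => k; apply: base_closed => e e0.
have [m tm] : exists m, t ^+ m < e * d ^+ k / d ^+ n.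
  apply: expr_lt_exists => //; first by rewrite t0.
  by rewrite divr_gt0 ?mulr_gt0.
have [g [_ _ /(_ k)]] := approx m; rewrite coefB coef_map /= => gk.
exists g`_k; rewrite -(ltr_pM2r (dX k)) (le_lt_trans gk) // mulrC.
by rewrite -ltr_pdivlMr.
Qed.

End BaseRing.

(** * Lower convex hulls and supporting lines *)

Section LowerHull.
Context {R : realType}.
Variables (S : set (@plane R)) (m s : R).

(** The level set l = m is a line of slope -s, and [S] lies on or above it. *)
Let l (P : @plane R) : R := P.2 + s * P.1.

Hypothesis S_ge : forall P, S P -> m <= l P.

Let lcomb (P Q : @plane R) (t : R) :
  l (t * P.1 + (1 - t) * Q.1, t * P.2 + (1 - t) * Q.2) = t * l P + (1 - t) * l Q.
Proof. by rewrite /l /=; ring. Qed.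

Let conv_ge (a b t : R) : 0 <= t -> t <= 1 -> m <= a -> m <= b ->
  m <= t * a + (1 - t) * b.
Proof. by nra. Qed.

Let conv_gt (a b t : R) : 0 <= t -> t <= 1 -> m <= a -> m <= b ->
  0 < t /\ m < a \/ t < 1 /\ m < b -> m < t * a + (1 - t) * b.
Proof. by move=> t0 t1 ma mb [[]|[]]; nra. Qed.

Let conv_le (x a b t : R) : 0 <= t -> t <= 1 -> a <= x -> b <= x ->
  t * a + (1 - t) * b <= x.
Proof. by nra. Qed.

Let conv_eq (a b t : R) : 0 < t -> t < 1 -> m <= a -> m <= b ->
  m = t * a + (1 - t) * b -> a = m /\ b = m.
Proof. by move=> t0 t1 ma mb e; split; nra. Qed.

Let conv_eq' (x a b t : R) : 0 < t -> t < 1 -> a <= x -> b <= x ->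
  x = t * a + (1 - t) * b -> a = x /\ b = x.
Proof. by move=> t0 t1 ma mb e; split; nra. Qed.

Lemma convex_hull_sub : S `<=` convex_hull S.
Proof. by move=> P SP K _; apply. Qed.

Lemma convex_planeP (K : set (@plane R)) :
  (forall (P Q : @plane R) (t : R), 0 <= t <= 1 -> K P -> K Q ->
     K (t * P.1 + (1 - t) * Q.1, t * P.2 + (1 - t) * Q.2)) ->
  convex_set (M := (R^o * R^o)%type) K.
Proof.
move=> cK P Q t /set_mem KP /set_mem KQ; apply/mem_set.
by apply: cK KP KQ; rewrite ge0 le1.
Qed.

Lemma convex_hull_segment (A B : @plane R) (t : R) : 0 <= t <= 1 -> S A -> S B ->
  convex_hull S (t * A.1 + (1 - t) * B.1, t * A.2 + (1 - t) * B.2).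
Proof.
move=> /andP[t0 t1] SA SB K cK SK.
have tP : Itv.spec (@Itv.num_sem R) (Itv.Real `[0%Z, 1%Z]) t.
  by rewrite /= /Itv.num_sem num_real /= in_itv /= t0.
have := cK A B (Itv.mk tP) (mem_set (SK _ SA)) (mem_set (SK _ SB)).
by move=> /set_mem.
Qed.

Lemma convex_hull_ge P : convex_hull S P -> m <= l P.
Proof.
move=> /(_ [set P | m <= l P]); apply=> [|{}P /S_ge//].
apply: convex_planeP => {}P Q t /andP[t0 t1] lP lQ.
rewrite /mkset lcomb; exact: conv_ge.
Qed.

(** At a fixed abscissa [l] increases with the ordinate, and it is at least [m] on the whole
    hull. *)
Lemma lower_hull_on_line P : S P -> l P = m -> lower_hull S P.
Proof.
move=> SP lP; split; first exact: convex_hull_sub.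
by move=> y /convex_hull_ge; rewrite -lP /l lerD2r.
Qed.

(** The set [K] of points on or above the line, and strictly above it beyond abscissa [x], is convex
    and contains [S], hence its hull. If an interior point of a segment in [K] is on the line, so
    are both ends; their abscissae are then at most [x], hence equal to [x]. *)
Lemma line_last_extremal (x y : R) (P Q : @plane R) (t : R) :
  y + s * x = m -> (forall P, S P -> x < P.1 -> m < l P) ->
  lower_hull S P -> lower_hull S Q -> 0 < t < 1 ->
  x = t * P.1 + (1 - t) * Q.1 -> y = t * P.2 + (1 - t) * Q.2 -> P = Q.
Proof.
move=> xym S_gt [hP _] [hQ _] /andP[t0 t1] ex ey.
pose K : set (@plane R) := [set P | m <= l P /\ (x < P.1 -> m < l P)].
have hK Z : convex_hull S Z -> K Z.
  move=> /(_ K); apply=> [|{}Z SZ]; last by split; [exact: S_ge | exact: S_gt].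
  apply: convex_planeP => {}Z Z' u /andP[u0 u1] [lZ gZ] [lZ' gZ'].
  rewrite /K /mkset lcomb; split; first exact: conv_ge.
  rewrite /fst => lt; apply: conv_gt => //.
  have [/gZ ltZ|leZ] := ltP x Z.1.
    have [u00|u00] := eqVneq u 0; last by left; rewrite lt_def u00.
    by right; move: lt; rewrite u00 mul0r subr0 mul1r add0r ltr01 => /gZ'.
  right; have [/gZ' ltZ'|leZ'] := ltP x Z'.1; last first.
    by move: lt; rewrite ltNge; move=> /negP[]; exact: (conv_le u0 u1).
  split=> //; rewrite lt_def u1 andbT; apply: contraTneq lt => <-.
  by rewrite -leNgt subrr mul0r mul1r addr0.
have [lP gP] := hK _ hP; have [lQ gQ] := hK _ hQ.
rewrite /l in lP gP lQ gQ.
have sum : m = t * (P.2 + s * P.1) + (1 - t) * (Q.2 + s * Q.1).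
  by rewrite -xym ex ey; ring.
have [eP eQ] : P.2 + s * P.1 = m /\ Q.2 + s * Q.1 = m by exact: conv_eq sum.
have P1 : P.1 <= x by rewrite leNgt; apply/negP => /gP; rewrite eP ltxx.
have Q1 : Q.1 <= x by rewrite leNgt; apply/negP => /gQ; rewrite eQ ltxx.
have [E1 E2] : P.1 = x /\ Q.1 = x by exact: conv_eq' ex.
have E : P.2 = Q.2 :> R by apply: (@addIr R (s * x)); rewrite -{1}E1 -{1}E2 eP eQ.
by move: E; rewrite [P]surjective_pairing [Q]surjective_pairing E1 E2 /= => ->.
Qed.

(** The point is squeezed between the supporting line and the segment from [A] to [B], which lies on
    that line. *)
Lemma line_middle_segment (A B : @plane R) (x y : R) :
  S A -> S B -> l A = m -> l B = m -> A.1 < x -> x < B.1 ->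
  lower_hull S (x, y) ->
  exists t, [/\ 0 < t < 1, x = t * A.1 + (1 - t) * B.1
    & y = t * A.2 + (1 - t) * B.2].
Proof.
move=> SA SB lA lB Ax xB [hxy low]; rewrite /l in lA lB.
pose t := (B.1 - x) / (B.1 - A.1).
have AB : 0 < B.1 - A.1 by rewrite subr_gt0 (lt_trans Ax).
have t0 : 0 < t by apply: divr_gt0 => //; rewrite subr_gt0.
have t1 : t < 1 by rewrite ltr_pdivrMr // mul1r ltrD2l ltrN2.
have xt : x = t * A.1 + (1 - t) * B.1.
  by rewrite /t; field; rewrite gt_eqF.
exists t; split=> //; first by rewrite t0.
have := @convex_hull_segment A B t; rewrite -xt !ltW // => /(_ isT SA SB) /low /= le1.
have := convex_hull_ge hxy; rewrite /l /= => le2.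
apply/eqP; rewrite eq_le le1 /=.
have -> : t * A.2 + (1 - t) * B.2 = m - s * x.
  by rewrite -lA [in RHS]xt (_ : B.2 = A.2 + s * A.1 - s * B.1); [ring | rewrite lA -lB; ring].
by rewrite lerBlDr.
Qed.

End LowerHull.

(** * Additivity of polynomials whose roots form a group *)

Section AdditivePolynomial.
Context {K : fieldType}.
Variable r : seq K.
Hypotheses (r_uniq : uniq r) (r_sub : forall x y, x \in r -> y \in r -> x - y \in r).
Let f := \prod_(x <- r) ('X - x%:P).

(** Translation by [c] permutes the roots. *)
Lemma prod_XsubC_shift c : c \in r -> f \Po ('X + c%:P) = f.
Proof.
move=> cr; rewrite /f (big_morph _ (fun p q => comp_polyM p q ('X + c%:P)) (comp_polyC 1 _)).
have rc : perm_eq [seq x - c | x <- r] r.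
  apply: uniq_perm => //; first by rewrite map_inj_uniq // => x y /addIr.
  apply: (uniq_min_size _ _ _).2; rewrite ?size_map ?map_inj_uniq //.
    by move=> x y /addIr.
  by move=> _ /mapP[x xr ->]; exact: r_sub.
rewrite -[RHS](perm_big _ rc) big_map; apply: eq_bigr => x _.
by rewrite comp_polyB comp_polyX comp_polyC polyCB opprB addrA addrAC.
Qed.

(** View f(X + Y) - f(X) - f(Y) as a polynomial in one variable with coefficients polynomial in the
    other. The leading terms cancel, so its degree is less than [size r], while every element of [r]
    is a root by translation invariance. *)
Lemma prod_XsubC_additive : 0 \in r -> poly_XaY f = f%:P + f^:P.
Proof.
move=> r0; apply/eqP; rewrite -subr_eq0; apply/eqP.
have mf : f \is monic by rewrite monic_prod_XsubC.
have mfP : f^:P \is monic by rewrite monic_map.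
have sXY : size ('X + 'X%:P : {poly {poly K}}) = 2 by rewrite size_XaddC.
apply: (@roots_geq_poly_eq0 _ _ [seq c%:P | c <- r]).
- apply/allP => _ /mapP[c cr ->]; apply/rootP.
  rewrite /poly_XaY hornerD hornerN hornerD horner_comp hornerD hornerX !hornerC.
  rewrite -/(comp_poly (c%:P + 'X) f) [c%:P + 'X]addrC.
  rewrite prod_XsubC_shift // -/(comp_poly c%:P f) comp_polyCr.
  have /rootP -> : root f c by rewrite root_prod_XsubC.
  by rewrite polyC0 addr0 subrr.
- by rewrite map_inj_uniq // => x y /polyC_inj.
have sf : size f = (size r).+1 by rewrite size_prod_XsubC.
have sfP : size f^:P = (size r).+1 by rewrite size_map_polyC.
have sXaY : size (poly_XaY f) = (size r).+1 by rewrite size_poly_XaY.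
have r_gt0 : (0 < size r)%N by case: (r) r0.
have lXaY : lead_coef (poly_XaY f) = 1.
  by rewrite lead_coef_comp ?sXY // (monicP mfP) lead_coefXaddC expr1n mulr1.
rewrite size_map; apply/leq_sizeP => j; rewrite leq_eqVlt coefB coefD coefC.
case/predU1P => [<-|rj].
  rewrite gtn_eqF // add0r.
  move: lXaY (monicP mfP); rewrite !lead_coefE sXaY sfP /= => -> ->.
  exact: subrr.
rewrite !nth_default ?sfP ?sXaY // gtn_eqF ?add0r ?subr0 ?addr0 // ?subrr ?oppr0 //.
exact: leq_ltn_trans rj.
Qed.

End AdditivePolynomial.

(** Additivity is an identity between polynomials in two variables: injectivity of [i] brings it
    down to [A], and [g] specializes it to [B], which may have zero divisors. *)
Lemma additive_points (A K : comNzRingType) (B : comNzRingType) (i : {rmorphism A -> K})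
    (g : {rmorphism A -> B}) (F : {poly A}) (x y : B) :
  injective i ->
  poly_XaY (map_poly i F) = (map_poly i F)%:P + (map_poly i F)^:P ->
  (map_poly g F).[x + y] = (map_poly g F).[x] + (map_poly g F).[y].
Proof.
move=> ij.
have mapXaY (A' B' : comNzRingType) (h : {rmorphism A' -> B'}) (G : {poly A'}) :
    map_poly (map_poly h) (poly_XaY G) = poly_XaY (map_poly h G).
  rewrite /poly_XaY map_comp_poly rmorphD /= map_polyX map_polyC /= map_polyX.
  by congr (_ \Po _); rewrite -!map_poly_comp; apply: eq_map_poly => c /=; rewrite map_polyC.
have mapC (A' B' : comNzRingType) (h : {rmorphism A' -> B'}) (G : {poly A'}) :
    map_poly (map_poly h) (G%:P + G^:P) = (map_poly h G)%:P + (map_poly h G)^:P.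
  rewrite rmorphD /= map_polyC /=; congr (_ + _).
  by rewrite -!map_poly_comp; apply: eq_map_poly => c /=; rewrite map_polyC.
rewrite -mapXaY -mapC => /map_inj_poly E.
have {}E : poly_XaY F = F%:P + F^:P.
  by apply: E; [apply: map_inj_poly; rewrite ?rmorph0 | rewrite rmorph0].
have := congr1 (fun G => (map_poly (map_poly g) G).[x%:P].[y]) E.
rewrite mapXaY mapC /poly_XaY horner_comp !hornerD hornerX !hornerC.
rewrite -/(comp_poly (x%:P + 'X) (map_poly g F)) -/(comp_poly x%:P (map_poly g F)).
by rewrite comp_polyCr hornerC horner_comp !hornerE addrC [RHS]addrC.
Qed.

Lemma seq_argmin {R : realType} {T : eqType} (N : T -> R) (s : seq T) x0 :
  x0 \in s -> exists2 x, x \in s & forall y, y \in s -> N x <= N y.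
Proof.
elim: s x0 => // a s IH _ _; case: s IH => [|b s] IH.
  by exists a; rewrite ?mem_head // => y; rewrite inE => /eqP ->.
have [x xs xmin] := IH b (mem_head _ _).
have [ax|xa] := leP (N a) (N x).
  exists a; rewrite ?mem_head // => y; rewrite inE => /predU1P[->//|/xmin].
  exact: le_trans.
exists x => [|y]; first by rewrite inE xs orbT.
by rewrite inE => /predU1P[->|/xmin//]; exact: ltW.
Qed.

Lemma finField_card_pnat (Fq : finFieldType) p k :
  p \in [pchar Fq] -> p.-nat (#|Fq| ^ k)%N.
Proof.
move=> pF; rewrite pnatX -cardsT; apply/orP; left.
exact: abelian.abelem_pgroup (abelian.fin_ring_pchar_abelem pF).
Qed.

(** * The torsion points and the action of polynomials on them *)

Section DrinfeldTorsion.
Context {R : realType} {Fq : finFieldType} {varpi : {poly Fq}}.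
Hypotheses (varpi_monic : varpi \is monic) (varpi_irr : irreducible_poly varpi).
Context {M : Cp_model R varpi} {O : base_ring M} {r : nat} {phi : {poly Fq} -> {poly O}}.
Hypothesis r_gt0 : (0 < r)%N.
Hypothesis phi_drinfeld : drinfeld_module r phi.
Context {H : nat -> O}.
Hypothesis phi_varpi : phi varpi =
  \sum_(i < (r * deg varpi).+1) H i *: 'X^(#|Fq| ^ i).

Let q := #|Fq|.
Let d := deg varpi.
Let N := @Cp_abs R Fq varpi M.
Let hN : nonarch_abs N := Cp_nonarch.
Let i := base_incl O.
Let act a x := drinfeld_act phi i a x.
Let P := map_poly i (phi varpi).

Let q_gt1 : (1 < q)%N. Proof. exact: finNzRing_gt1. Qed.
Let q_gt0 : (0 < q)%N. Proof. exact: ltnW. Qed.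
Let d_gt0 : (0 < d)%N.
Proof. by rewrite /d /deg -ltnS prednK ?varpi_size // ltnW // varpi_size. Qed.

Lemma Cp_pchar p : p \in [pchar Fq] -> p \in [pchar Cp M].
Proof.
move=> pF; apply: (rmorph_pchar (Cp_of M)); apply: (rmorph_pchar (Kbar_of M)).
apply: (rmorph_pchar (@FracField.tofrac (Ap M))).
by apply: (rmorph_pchar (Ap_of M)); rewrite pchar_poly.
Qed.

Lemma Cp_pchar_nat k : [pchar Cp M].-nat (q ^ k)%N.
Proof.
have [p _ pF] := finPcharP Fq.
rewrite (eq_pnat _ (pcharf_eq (Cp_pchar pF))).
exact: finField_card_pnat.
Qed.

Lemma drinfeld_actE a : exists n (c : nat -> O), forall x,
  act a x = \sum_(k < n) i (c k) * x ^+ (q ^ k).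
Proof.
have [n [c cE]] := drinfeld_linear phi_drinfeld a; exists n, c => x.
rewrite /act /drinfeld_act cE rmorph_sum horner_sum /=; apply: eq_bigr => k _.
by rewrite map_polyZ map_polyXn hornerZ hornerXn.
Qed.

Lemma drinfeld_actD a x y : act a (x + y) = act a x + act a y.
Proof.
have [n [c cE]] := drinfeld_actE a; rewrite !cE -big_split; apply: eq_bigr => k _ /=.
by rewrite exprDn_pchar ?Cp_pchar_nat // mulrDr.
Qed.

Lemma drinfeld_act_0 a : act a 0 = 0.
Proof. by apply: (addrI (act a 0)); rewrite -drinfeld_actD !addr0. Qed.

Lemma drinfeld_actN a x : act a (- x) = - act a x.
Proof. by apply: (addrI (act a x)); rewrite -drinfeld_actD !subrr drinfeld_act_0. Qed.

Lemma drinfeld_act_add a b x : act (a + b) x = act a x + act b x.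
Proof. by rewrite /act /drinfeld_act (drinfeldD phi_drinfeld) rmorphD hornerD. Qed.

Lemma drinfeld_act_mul a b x : act (a * b) x = act a (act b x).
Proof.
by rewrite /act /drinfeld_act (drinfeldM phi_drinfeld) map_comp_poly horner_comp.
Qed.

Lemma drinfeld_act_1 x : act 1 x = x.
Proof. by rewrite /act /drinfeld_act (drinfeld1 phi_drinfeld) map_polyX hornerX. Qed.

Lemma drinfeld_act_sub a b x : act (a - b) x = act a x - act b x.
Proof. by apply: (addIr (act b x)); rewrite -drinfeld_act_add !subrK. Qed.

(** Coefficients have absolute value at most 1 and all exponents are positive. Hence discs about 0
    of radius at most 1 are stable under the action. *)
Lemma drinfeld_act_abs a x : N x <= 1 -> N (act a x) <= N x.
Proof.
move=> x1; have [n [c ->]] := drinfeld_actE a.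
apply: (nabs_sum_le hN) => [|k _]; first exact: abs_ge0 hN _.
rewrite (absM hN) (nabsX hN) -[leRHS]mul1r ler_pM ?exprn_ge0 ?(abs_ge0 hN) //.
  exact: base_abs_le1.
by rewrite -[leRHS]expr1 ler_wiXn2l ?(abs_ge0 hN) ?expn_gt0 ?q_gt0.
Qed.

Lemma sum_Xq_coef (A : nzRingType) (c : nat -> A) n k : (k < n)%N ->
  (\sum_(j < n) c j *: 'X^(q ^ j))`_(q ^ k) = c k.
Proof.
move=> kn; rewrite coef_sum (bigD1 (Ordinal kn)) //= coefZ coefXn eqxx mulr1.
rewrite big1 ?addr0 // => j; rewrite -val_eqE /= => jk.
rewrite coefZ coefXn eqn_exp2l // eq_sym.
by rewrite (negbTE jk) mulr0.
Qed.

Lemma torsion_poly_coef k : (k <= r * d)%N -> P`_(q ^ k) = i (H k).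
Proof. by move=> kn; rewrite coef_map phi_varpi sum_Xq_coef. Qed.

(** [drinfeld_rank] provides some expansion of [phi varpi]; comparing coefficients at the exponents
    q^k identifies it with the given one. *)
Lemma H_extremal : i (H 0%N) = A_to_Cp M varpi /\ N (i (H (r * d)%N)) = 1.
Proof.
have [H' [E H'0 H'u]] := drinfeld_rank phi_drinfeld.
have HE k : (k <= r * d)%N -> H k = H' k.
  move=> kn; have := congr1 (fun p : {poly O} => p`_(q ^ k)) E.
  by rewrite phi_varpi !sum_Xq_coef.
by rewrite !HE //; split=> //; exact: base_unit_abs.
Qed.

Lemma torsion_poly_size : size P = (q ^ (r * d)).+1.
Proof.
have PE : P = \sum_(k < (r * d).+1) i (H k) *: 'X^(q ^ k).
  rewrite /P phi_varpi rmorph_sum /=; apply: eq_bigr => k _.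
  by rewrite map_polyZ map_polyXn.
have top : size (i (H (r * d)%N) *: 'X^(q ^ (r * d))) = (q ^ (r * d)).+1.
  rewrite size_scale ?size_polyXn // -(nabs_eq0 hN).
  by have [_ ->] := H_extremal; rewrite oner_eq0.
rewrite PE big_ord_recr /= addrC size_polyDl ?top //.
apply: leq_ltn_trans (size_sum _ _ _) _; rewrite ltnS; apply/bigmax_leqP => j _.
by apply: leq_trans (size_scale_leq _ _) _; rewrite size_polyXn ltn_exp2l.
Qed.

(** Every exponent q^k with k > 0 is divisible by the characteristic, so only the linear term
    contributes. *)
Lemma torsion_poly_deriv : P^`() = (A_to_Cp M varpi)%:P.
Proof.
rewrite /P phi_varpi rmorph_sum raddf_sum /= big_ord_recl /= big1 ?addr0.
  rewrite map_polyZ map_polyXn derivZ derivXn expn0 expr0 alg_polyC.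
  by have [->] := H_extremal.
move=> j _; rewrite map_polyZ map_polyXn derivZ derivXn /=.
have [p p_pr pF] := finPcharP Fq.
have : (p %| q ^ bump 0 j)%N.
  have := finField_card_pnat 1 pF; rewrite expn1 => /p_natP[m qE].
  rewrite /q qE -expnM dvdn_exp // muln_gt0 andbC /=; case: m qE => // qE.
  by move: q_gt1; rewrite /q qE.
move=> /dvdnP[m ->]; rewrite mulrnA -mulr_natr -polyC_natr.
by rewrite (pcharf0 (Cp_pchar pF)) mulr0 scaler0.
Qed.

(** The roots are distinct because the derivative of [P] is a nonzero constant. *)
Lemma torsion_poly_split : exists rs : seq (Cp M),
  [/\ uniq rs, P = i (H (r * d)%N) *: \prod_(x <- rs) ('X - x%:P)
    & size rs = (q ^ (r * d))%N].
Proof.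
have [rs] := closed_field_split P Cp_closed.
rewrite lead_coefE torsion_poly_size /= torsion_poly_coef // => PE.
have c0 : i (H (r * d)%N) != 0.
  by rewrite -(nabs_eq0 hN); have [_ ->] := H_extremal; rewrite oner_eq0.
exists rs; split=> //; last first.
  by apply: succn_inj; rewrite -torsion_poly_size PE size_scale // size_prod_XsubC.
rewrite -separable_prod_XsubC; set f := \prod_(_ <- _) _ in PE *.
have -> : f = (i (H (r * d)%N))^-1 *: P by rewrite PE scalerA mulVf // scale1r.
rewrite separable_poly.unlock derivZ torsion_poly_deriv -alg_polyC.
rewrite coprimepZl ?invr_eq0 // !coprimepZr ?invr_eq0 ?coprimep1 //.
by rewrite -(nabs_gt0 hN); have /andP[] := varpi_abs varpi_monic varpi_irr (M := M).
Qed.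

(** For |x| > 1 the top term, whose coefficient is a unit, would strictly dominate all the
    others. *)
Lemma torsion_abs_le1 x : torsion phi x -> N x <= 1.
Proof.
rewrite /torsion /= /drinfeld_act phi_varpi rmorph_sum horner_sum big_ord_recr /=.
move=> /eqP; rewrite addr_eq0 => /eqP xE; rewrite leNgt; apply/negP => x1.
have x0 : 0 < N x := lt_trans ltr01 x1.
have evalE k : N (map_poly i (H k *: 'X^(q ^ k))).[x] = N (i (H k)) * N x ^+ (q ^ k).
  by rewrite map_polyZ map_polyXn hornerZ hornerXn (absM hN) (nabsX hN).
have : N (\sum_(k < r * d) (map_poly i (H k *: 'X^(q ^ k))).[x]) < N x ^+ (q ^ (r * d)).
  apply: (nabs_sum_lt hN) => [|k _]; first exact: exprn_gt0.
  rewrite evalE (le_lt_trans (ler_wpM2r _ (base_abs_le1 varpi_monic varpi_irr (H k)))) //.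
    by rewrite exprn_ge0 // ltW.
  by rewrite mul1r ltr_eXn2l // ltn_exp2l.
by rewrite xE (nabsN hN) evalE; have [_ ->] := H_extremal; rewrite mul1r ltxx.
Qed.

Lemma torsion_act a x : torsion phi x -> torsion phi (act a x).
Proof.
move=> tx; rewrite /torsion /= -/i -/(act _ _) -drinfeld_act_mul mulrC drinfeld_act_mul.
by rewrite [act varpi x]tx drinfeld_act_0.
Qed.

(** In a Bezout relation between [a] and [varpi], the multiple of [varpi] kills the torsion. *)
Lemma torsion_act_inv a : ~~ (varpi %| a) ->
  exists b, forall x, torsion phi x -> act b (act a x) = x.
Proof.
rewrite -irreducible_poly_coprime // => /Bezout_coprimepP[u].
rewrite -size_poly_eq1 => /size_poly1P[c c0 uE].
exists (c^-1%:P * u.2) => x tx; rewrite -[RHS]drinfeld_act_1.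
have -> : 1 = c^-1%:P * u.1 * varpi + c^-1%:P * u.2 * a.
  by rewrite -!mulrA -mulrDr uE -polyCM mulVf.
rewrite drinfeld_act_add !drinfeld_act_mul [act varpi x]tx.
by rewrite !drinfeld_act_0 add0r.
Qed.

(** The difference of two distinct representatives has degree below that of [varpi], so it acts
    invertibly on the torsion and cannot kill [e]. *)
Lemma torsion_orbit_inj e : torsion phi e -> e != 0 ->
  injective (fun c : {poly %/ varpi} => act c e).
Proof.
move=> te e0 c c' /eqP; rewrite -subr_eq0 -drinfeld_act_sub => /eqP cc0.
apply/val_inj/eqP; rewrite /= -subr_eq0; apply: contraNT e0 => nz.
have c_size (a : {poly %/ varpi}) : (size (a : {poly Fq}) < size varpi)%N.
  have mE : mk_monic varpi = varpi by rewrite /mk_monic varpi_size // varpi_monic.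
  by apply: leq_trans (size_mk_monic a) _; rewrite mE.
have [|b /(_ e te)] := @torsion_act_inv ((c : {poly Fq}) - c').
  apply/negP => /(dvdp_leq nz); rewrite leqNgt => /negP; apply.
  by rewrite (leq_ltn_trans (size_polyD _ _)) // size_polyN gtn_max !c_size.
by rewrite cc0 drinfeld_act_0 => <-.
Qed.

(** [C] and [S] sort the roots of [P] by absolute value. By finiteness [delta0] is attained at some
    nonzero root [e], and its minimality forces every nonzero element of [C] to have that same
    absolute value. *)
Lemma torsion_filtration (dl := delta0 phi) : 0 < dl /\
  exists C S : seq (Cp M),
  [/\ uniq C, forall x, torsion_le_delta0 phi x <-> x \in C,
      (forall x, x \in C -> x != 0 -> N x = dl) /\ (exists2 e, e \in C & e != 0),
      forall x, x \in S -> dl < N x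
    & P = i (H (r * d)%N) *:
        (\prod_(x <- C) ('X - x%:P) * \prod_(x <- S) ('X - x%:P))].
Proof.
have [rs [urs PE srs]] := torsion_poly_split.
have c0 : i (H (r * d)%N) != 0.
  by rewrite -(nabs_eq0 hN); have [_ ->] := H_extremal; rewrite oner_eq0.
have tE x : torsion phi x <-> x \in rs.
  rewrite -root_prod_XsubC -(rootZ _ _ c0) -PE.
  by split=> [/rootP//|/rootP].
have [x1 x1P] : exists x, x \in [seq x <- rs | x != 0].
  apply: contrapT => nex.
  have /uniq_leq_size : {subset rs <= [:: 0]}.
    move=> x xrs; rewrite inE; apply/negPn/negP => x0; apply: nex.
    by exists x; rewrite mem_filter x0.
  move=> /(_ urs); rewrite srs /= leqNgt -[X in (X < _)%N](expn0 q) ltn_exp2l //.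
  by rewrite muln_gt0 r_gt0 d_gt0.
have [e] := seq_argmin N x1P; rewrite mem_filter => /andP[e0 ers] emin.
have dE : dl = N e.
  rewrite /dl /delta0; apply/eqP; rewrite eq_le; apply/andP; split.
    apply: ge_inf; last by exists e => //; split=> //; exact/tE.
    by exists 0 => _ [x _ <-]; exact: abs_ge0 hN _.
  apply: lb_le_inf; first by exists (N e), e => //; split=> //; exact/tE.
  by move=> _ [x [/tE xrs x0] <-]; apply: emin; rewrite mem_filter xrs andbT.
have dl0 : 0 < dl by rewrite dE (nabs_gt0 hN).
split=> //; exists [seq x <- rs | N x <= dl], [seq x <- rs | ~~ (N x <= dl)].
split.
- exact: filter_uniq.
- move=> x; rewrite mem_filter; split=> [[/tE -> /= le]|/andP[le /tE tx]] //.
  by rewrite andbT.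
- split; last by exists e; rewrite // mem_filter ers dE lexx.
  move=> x; rewrite mem_filter => /andP[le xrs] x0; apply/eqP.
  by rewrite eq_le le dE emin // mem_filter x0.
- by move=> x; rewrite mem_filter => /andP[]; rewrite -ltNge.
by rewrite PE; congr (_ *: _); rewrite -big_cat /=; apply/esym/perm_big/permPl/perm_filterC.
Qed.

(** * The canonical submodule, the vertex and the scheme *)

Section Filtration.
Variables C S : seq (Cp M).
Let dl := delta0 phi.
Let n := size C.
Let c := i (H (r * d)%N).
Let f := \prod_(x <- C) ('X - x%:P).
Hypotheses (dl_gt0 : 0 < dl) (C_uniq : uniq C).
Hypothesis C_torsion : forall x, torsion_le_delta0 phi x <-> x \in C.
Hypothesis C_abs : forall x, x \in C -> x != 0 -> N x = dl.
Hypothesis C_neq0 : exists2 e, e \in C & e != 0.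
Hypothesis S_abs : forall x, x \in S -> dl < N x.
Hypothesis P_split : P = c *: (f * \prod_(x <- S) ('X - x%:P)).

Let c_neq0 : c != 0.
Proof. by rewrite -(nabs_eq0 hN); have [_ ->] := H_extremal; rewrite oner_eq0. Qed.

Let C_le x : x \in C -> N x <= dl. Proof. by move=> /C_torsion[]. Qed.

Let C_sub_torsion x : x \in C -> torsion phi x. Proof. by move=> /C_torsion[]. Qed.

Let C0 : 0 \in C.
Proof.
apply/C_torsion; split; first exact: drinfeld_act_0.
by change (N 0 <= dl); rewrite (nabs0 hN) ltW.
Qed.

Let C_add x y : x \in C -> y \in C -> x + y \in C.
Proof.
move=> /C_torsion[tx lx] /C_torsion[ty ly]; apply/C_torsion; split.
  by change (act varpi (x + y) = 0); rewrite drinfeld_actD [act _ x]tx [act _ y]ty addr0.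
exact: (nabsD_le hN lx ly).
Qed.

Let C_sub x y : x \in C -> y \in C -> x - y \in C.
Proof.
move=> xC /C_torsion[ty ly]; apply: C_add => //; apply/C_torsion; split.
  by change (act varpi (- y) = 0); rewrite drinfeld_actN [act _ y]ty oppr0.
by change (N (- y) <= dl); rewrite (nabsN hN).
Qed.

Let C_act a x : x \in C -> act a x \in C.
Proof.
move=> /C_torsion[tx lx]; apply/C_torsion; split; first exact: torsion_act.
exact: le_trans (drinfeld_act_abs a (torsion_abs_le1 tx)) lx.
Qed.

Let card_kappa : #|{poly %/ varpi}| = (q ^ d)%N.
Proof. by rewrite card_monic_qpoly ?varpi_size. Qed.

Let orbit e := [seq act (a : {poly %/ varpi}) e | a <- enum {poly %/ varpi}].

Let orbit_uniq e : e \in C -> e != 0 -> uniq (orbit e).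
Proof.
by move=> /C_sub_torsion te e0; rewrite map_inj_uniq ?enum_uniq //; exact: torsion_orbit_inj.
Qed.

Let orbit_sub e : e \in C -> {subset orbit e <= C}.
Proof. by move=> eC _ /mapP[a _ ->]; exact: C_act. Qed.

Let size_orbit e : size (orbit e) = (q ^ d)%N.
Proof. by rewrite size_map -cardE. Qed.

Lemma canonical_card_ge : (q ^ d <= n)%N.
Proof.
have [e eC e0] := C_neq0.
by rewrite -(size_orbit e) uniq_leq_size ?orbit_uniq //; exact: orbit_sub.
Qed.

Lemma canonical_free_rank1 :
  free_rank1 phi (torsion_le_delta0 phi) <-> n = (q ^ d)%N.
Proof.
split=> [[_ _ [e /C_torsion eC [_ _ surj]]]|nq].
  apply/eqP; rewrite eqn_leq canonical_card_ge andbT -(size_orbit e).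
  apply: uniq_leq_size => // x /C_torsion /surj[a _ <-].
  by apply/mapP; exists a; rewrite ?mem_enum.
have [e eC e0] := C_neq0; split.
- split; first exact/C_torsion.
    by move=> x y /C_torsion xC /C_torsion yC; apply/C_torsion/C_add.
  by move=> a x /C_torsion xC; apply/C_torsion/C_act.
- by move=> x [].
exists e; first exact/C_torsion; split.
- by move=> a _; apply/C_torsion/C_act.
- by move=> a b _ _; apply: torsion_orbit_inj => //; exact: C_sub_torsion.
move=> x /C_torsion xC.
have [|_ oE] := uniq_min_size (orbit_uniq eC e0) (@orbit_sub e eC).
  by rewrite size_orbit -nq.
by move: xC; rewrite -oE => /mapP[a _ ->]; exists a.
Qed.

(** With the next two facts, this locates the first edge of the Newton polygon: the points at 1 and
    [n] are on its line, and all points beyond [n] lie strictly above it. *)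
Let P_le k : N P`_k * dl ^+ k <= N P`_n * dl ^+ n.
Proof. by have := slope_coef_le hN dl_gt0 c C_le S_abs; rewrite -P_split; apply. Qed.

Let P_lt k : (n < k)%N -> N P`_k * dl ^+ k < N P`_n * dl ^+ n.
Proof. by have := slope_coef_lt hN dl_gt0 c_neq0 C_le S_abs; rewrite -P_split; apply. Qed.

Let P_1 : N P`_1 * dl = N P`_n * dl ^+ n.
Proof.
by have := slope_coef_1 hN dl_gt0 c C_le S_abs C_uniq C0 C_abs; rewrite -P_split.
Qed.

Let P_n_neq0 : P`_n != 0.
Proof. by have := slope_coef_neq0 hN dl_gt0 c_neq0 C_le S_abs; rewrite -P_split. Qed.

Let P1E : P`_1 = A_to_Cp M varpi.
Proof. by rewrite -(expn0 q) torsion_poly_coef //; have [] := H_extremal. Qed.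

(** Otherwise, comparing the top term with the linear one would give dl^(q^(rd)) <= |varpi| dl < dl
    <= dl^(q^(rd)). *)
Lemma delta0_lt1 : dl < 1.
Proof.
rewrite ltNge; apply/negP => dl1.
have /andP[_ w1] := varpi_abs varpi_monic varpi_irr (M := M).
have := P_le (q ^ (r * d))%N; rewrite -P_1 P1E torsion_poly_coef //.
have [_ ->] := H_extremal; rewrite mul1r => le.
suff : dl <= dl ^+ (q ^ (r * d)).
  by move=> /le_trans /(_ le); rewrite leNgt gtr_pMl // w1.
by rewrite -[leLHS]expr1 ler_weXn2l // expn_gt0 q_gt0.
Qed.

Lemma canonical_vertex :
  newton_vertex (@cp_val R Fq varpi M) P (q ^ d)%:R (cp_val (i (H d))) <->
  n = (q ^ d)%N.
Proof.
pose lw := ln (N (A_to_Cp M varpi)).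
have lw0 : lw < 0 by exact: ln_lt0 (varpi_abs varpi_monic varpi_irr (M := M)).
(* [s] and [m] are the valuations that correspond to the absolute values [dl] and [B]. As [lw] is
   negative, |P_k| dl^k <= B becomes y + s x >= m. *)
pose s := ln dl / lw; pose B := N P`_n * dl ^+ n; pose m := ln B / lw.
pose pt k : @plane R := (k%:R, ln (N P`_k) / lw).
have dX k : 0 < dl ^+ k by exact: exprn_gt0.
have B0 : 0 < B by rewrite mulr_gt0 ?(nabs_gt0 hN).
have pt_l k : P`_k != 0 -> (pt k).2 + s * (pt k).1 = ln (N P`_k * dl ^+ k) / lw.
  move=> k0; rewrite lnM ?posrE ?(nabs_gt0 hN) // lnXn // -[ln dl *+ k]mulr_natr.
  by rewrite mulrDl [ln dl * _ / _]mulrAC.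
have ptP (Z : @plane R) : newton_points (@cp_val R Fq varpi M) P Z ->
    exists2 k, P`_k != 0 & Z = pt k.
  case: Z => x y [k [/= -> yE]].
  have k0 : P`_k != 0 by apply: contra_eq_neq yE => ->; rewrite /cp_val eqxx.
  by exists k => //; move: yE; rewrite cp_valE // => -[<-].
have pt_in k : P`_k != 0 -> newton_points (@cp_val R Fq varpi M) P (pt k).
  by move=> k0; exists k; rewrite cp_valE.
have S_ge Z : newton_points (@cp_val R Fq varpi M) P Z -> m <= Z.2 + s * Z.1.
  move=> /ptP[k k0 ->]; rewrite pt_l // ler_nM2r ?invr_lt0 //.
  by rewrite ler_ln ?posrE ?mulr_gt0 ?(nabs_gt0 hN).
have ptn : (pt n).2 + s * (pt n).1 = m by rewrite pt_l.
split=> [[y0 [yE hull ext]]|nq].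
  apply/eqP; rewrite eqn_leq canonical_card_ge andbT leqNgt; apply/negP => lt_n.
  have P1_neq0 : P`_1 != 0.
    by rewrite P1E -(nabs_gt0 hN); have /andP[] := varpi_abs varpi_monic varpi_irr (M := M).
  have pt1 : (pt 1%N).2 + s * (pt 1%N).1 = m by rewrite pt_l // expr1 P_1.
  (* With 1 < q^d < n, the alleged vertex is interior to the segment joining [pt 1] and [pt n];
     extremality then forces n = 1. *)
  have [||t [t01 xE y0E]] := line_middle_segment S_ge (pt_in _ P1_neq0)
      (pt_in _ P_n_neq0) pt1 ptn _ _ hull.
  - by rewrite ltr_nat -(expn0 q) ltn_exp2l.
  - by rewrite ltr_nat.
  have := ext _ _ t (lower_hull_on_line S_ge (pt_in _ P1_neq0) pt1)
    (lower_hull_on_line S_ge (pt_in _ P_n_neq0) ptn) t01 xE y0E.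
  move=> [/eqP]; rewrite eqr_nat => /eqP n1.
  by move: lt_n; rewrite -n1 ltnNge expn_gt0 q_gt0.
have HdE : i (H d) = P`_n.
  by rewrite nq torsion_poly_coef // leq_pmull.
rewrite HdE cp_valE // -nq; exists (ln (N P`_n) / lw); split=> //.
  exact: (lower_hull_on_line S_ge (pt_in _ P_n_neq0) ptn).
move=> Z Z' t; apply: (line_last_extremal S_ge ptn) => {Z Z' t} Z /ptP[k k0 ->].
rewrite ltr_nat pt_l // => nk; rewrite ltr_nM2r ?invr_lt0 // ltr_ln ?posrE //.
  exact: P_lt.
by rewrite mulr_gt0 ?(nabs_gt0 hN).
Qed.

(** The ideal is generated by a lift [F] to [O[X]] of the product over [C]. Stability on the points
    of every [B] follows from statements over [O]: additivity of [F], and divisibility by [F] of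
    [F \Po phi a], which is tested on [C]. *)
Lemma canonical_scheme_exists :
  exists2 I : set {poly O}, torsion_submodule_scheme phi I
    & scheme_points I i = torsion_le_delta0 phi.
Proof.
have [F FE] := base_slope_factor varpi_monic varpi_irr dl_gt0 delta0_lt1 c_neq0
  C_le S_abs P_split.
have mF : F \is monic.
  rewrite monicE -(inj_eq (@base_inj _ _ _ _ O)) rmorph1.
  by rewrite -(lead_coef_map_inj (@base_inj _ _ _ _ O)) ?rmorph0 // FE -monicE monic_prod_XsubC.
pose I : set {poly O} := [set p | exists h, p = h * F].
have ptsE (B : comNzRingType) (g : {rmorphism O -> B}) x :
    scheme_points I g x <-> (map_poly g F).[x] = 0.
  split=> [|Fx _ [h ->]]; first by apply; exists 1; rewrite mul1r.
  by rewrite rmorphM hornerM /= Fx mulr0.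
have rootF x : (map_poly i F).[x] = 0 <-> x \in C.
  by rewrite FE -root_prod_XsubC; split=> /rootP.
(* As [C] has no repetitions, vanishing on it gives divisibility over C_p, which descends to [O]
   because [F] is monic. *)
have dvdF (p : {poly O}) : (forall x, x \in C -> (map_poly i p).[x] = 0) ->
    exists h, p = h * F.
  move=> p0; apply: map_incl_dvdp => //; rewrite FE.
  apply: uniq_roots_dvdp; last by rewrite uniq_rootsE.
  by apply/allP => x /p0 px; apply/rootP.
exists I; last first.
  apply/seteqP; split=> x.
    by move=> Ix; apply/C_torsion/rootF/ptsE.
  by move=> /C_torsion/rootF Fx; apply/ptsE.
split.
- split.
  + by exists 0; rewrite mul0r.
  + by move=> _ _ [h ->] [h' ->]; exists (h + h'); rewrite mulrDl.
  + by move=> h _ [h' ->]; exists (h * h'); rewrite mulrA.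
- by apply: dvdF => x /C_sub_torsion.
move=> B g; split.
- apply/ptsE; rewrite horner_coef0 coef_map /=.
  have -> : F`_0 = 0.
    apply: (@base_inj _ _ _ _ O); rewrite rmorph0 -coef_map -horner_coef0.
    exact/rootF.
  by rewrite rmorph0.
- move=> x y /ptsE Fx /ptsE Fy; apply/ptsE.
  rewrite (@additive_points _ _ _ i g F x y (@base_inj _ _ _ _ O)) ?Fx ?Fy ?addr0 //.
  by rewrite FE prod_XsubC_additive.
move=> a x /ptsE Fx; apply/ptsE.
have [y yC|h hE] := dvdF (F \Po phi a).
  by rewrite map_comp_poly horner_comp; apply/rootF/C_act.
rewrite /drinfeld_act -horner_comp -map_comp_poly hE rmorphM hornerM /=.
by rewrite Fx mulr0.
Qed.

End Filtration.

End DrinfeldTorsion.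

Unset Implicit Arguments.
Set Strict Implicit.
Set Printing Implicit Defensive.

Theorem theorem3p7 (R : realType) (Fq : finFieldType) (varpi : {poly Fq})
    (varpi_monic : varpi \is monic) (varpi_irr : irreducible_poly varpi)
    (M : Cp_model R varpi) (O : base_ring M)
    (r : nat) (r_ge2 : (2 <= r)%N)
    (phi : {poly Fq} -> {poly O}) (phi_drinfeld : drinfeld_module r phi)
    (H : nat -> O)
    (phi_varpi : phi varpi =
       \sum_(i < (r * deg varpi).+1) H i *: 'X^(#|Fq| ^ i)) :
  (exists I : set {poly O}, canonical_submodule_scheme phi I) <->
  newton_vertex (@cp_val R Fq varpi M) (map_poly (base_incl O) (phi varpi))
    (#|Fq| ^ deg varpi)%:R (cp_val (base_incl O (H (deg varpi)))).
Proof.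
have r_gt0 : (0 < r)%N := ltnW r_ge2.
have [dl0 [C [S [uC CP [Cabs Cnz] Sabs PE]]]] :=
  torsion_filtration varpi_monic varpi_irr r_gt0 phi_drinfeld phi_varpi.
have free := canonical_free_rank1 varpi_monic varpi_irr phi_drinfeld phi_varpi
  dl0 uC CP Cnz.
have vertex := canonical_vertex varpi_monic varpi_irr r_gt0 phi_drinfeld phi_varpi
  dl0 uC CP Cabs Cnz Sabs PE.
have [I tI ptsI] := canonical_scheme_exists varpi_monic varpi_irr phi_drinfeld
  phi_varpi dl0 uC CP Cabs Sabs PE.
(* Both sides are equivalent to [size C] being q^d; for the converse, [I] supplies the scheme. *)
split=> [[J [_ /free nq _]]|/vertex /free frk]; first exact/vertex.
by exists I; split.
Qed.
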